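(* Let $d\ge1$, $r\ge 0$, $\mathcal{C}=\mathcal{C}([-r,0],\mathbb{R}^d)$, let $f:\mathbb{R}_+\times\mathcal{C}\to\mathbb{R}^d$, $(t,x)\mapsto f(t,x)$, be a continuous function and let $\phi\in\mathcal{C}$. Suppose that: (H1) $f$ is continuous in the second variable uniformly with respect to the first one, i.e. for every $x\in\mathcal{C}$ and every $\eta>0$ there is $\kappa>0$ such that $|f(t,x')-f(t,x)|<\eta$ for all $t\in\mathbb{R}_+$ and all $x'\in\mathcal{C}$ with $\|x'-x\|<\kappa$; (H2) for every bounded subset $B$ of $\mathcal{C}$, $f$ is bounded on $\mathbb{R}_+\times B$; (H3) for all $x\in\mathcal{C}$ the limit $F(x):=\lim_{T\to\infty}\frac1T\int_0^T f(t,x)\,dt$ exists; (H6) the initial value problem $\dot y(t)=F(y_t)$, $y_0=\phi$, has a unique solution. Let $y$ be the solution of the problem in (H6) and let $L\in J$ be positive, where $J$ is the interval of definition of $y$. Then for every $\delta>0$ there exists $\varepsilon_0=\varepsilon_0(L,\delta)>0$ such that, for all $\varepsilon\in(0,\varepsilon_0]$, every solution $x$ of the initial value problem $$\dot x(t)=f(t/\varepsilon,x_t),\qquad x_0=\phi,$$ is defined at least on $[-r,L]$ and satisfies $|x(t)-y(t)|<\delta$ for all $t\in[0,L]$.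
   Context: $\mathbb{R}_+=[0,\infty)$, $|\cdot|$ is a norm on $\mathbb{R}^d$, and $\mathcal{C}=\mathcal{C}([-r,0],\mathbb{R}^d)$ is the Banach space of continuous functions $[-r,0]\to\mathbb{R}^d$ with norm $\|\phi\|=\sup_{\theta\in[-r,0]}|\phi(\theta)|$ (identified with $\mathbb{R}^d$ when $r=0$). For a continuous function $x$ on an interval containing $[t-r,t]$, $x_t\in\mathcal{C}$ is given by $x_t(\theta)=x(t+\theta)$, $\theta\in[-r,0]$. A solution of a retarded problem is a continuous function on an interval starting at $-r$, equal to $\phi$ on $[-r,0]$ and satisfying the equation for $t\ge0$. Solutions are considered forward in time and are understood to be maximal (non-continuable to the right). ''Unique solution'' means that there is exactly one maximal solution and every solution is a restriction of it; its interval of definition $J$ is of the form $[-r,\omega)$ with $0<\omega\le\infty$. (Under (H1) and (H3) the function $F$ is continuous.) *)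

(* Defs.v *)
From HB Require Import structures.
From mathcomp Require Import all_boot all_order all_algebra.
From mathcomp Require Import all_classical all_reals all_analysis.
Set Implicit Arguments.
Unset Strict Implicit.
Unset Printing Implicit Defensive.
Import Order.TTheory GRing.Theory Num.Theory.
Import numFieldNormedType.Exports.
Local Open Scope classical_set_scope.
Local Open Scope ring_scope.

(* An arbitrary norm on R^d. The canonical norm of ['rV[R]_d] in the library
   is the sup norm; it is used below only through the topology it induces. *)
Definition is_norm (R : realType) (d : nat) (N : 'rV[R]_d -> R) : Prop :=
  [/\ forall x y, N (x + y) <= N x + N y,
      forall a x, N (a *: x) = `|a| * N x &
      forall x, N x = 0 -> x = 0].

Definition Cspace (R : realType) (d : nat) (r : R) : Type :=
  continuousType (set_type `[- r, 0]%classic) 'rV[R]_d.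

Definition Cnorm (R : realType) (d : nat) (r : R) (N : 'rV[R]_d -> R)
    (u : set_type `[- r, 0]%classic -> 'rV[R]_d) : R :=
  sup (range (fun theta => N (u theta))).

Definition Cdist (R : realType) (d : nat) (r : R) (N : 'rV[R]_d -> R)
    (u v : Cspace d r) : R :=
  Cnorm N (fun theta => u theta - v theta).

(* [f : R -> Cspace d r -> 'rV[R]_d] stands for a map on R_+ x C: its values at
   negative times are never constrained nor used. *)
Definition continuous_on_Rplus (R : realType) (d : nat) (r : R)
    (N : 'rV[R]_d -> R) (f : R -> Cspace d r -> 'rV[R]_d) : Prop :=
  forall (t : R) (u : Cspace d r), 0 <= t ->
  forall eta : R, 0 < eta -> exists2 kappa : R, 0 < kappa &
  forall (t' : R) (u' : Cspace d r), 0 <= t' ->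
    `|t' - t| < kappa -> Cdist N u' u < kappa -> N (f t' u' - f t u) < eta.

Definition equicontinuous_in_state (R : realType) (d : nat) (r : R)
    (N : 'rV[R]_d -> R) (f : R -> Cspace d r -> 'rV[R]_d) : Prop :=
  forall (u : Cspace d r) (eta : R), 0 < eta -> exists2 kappa : R, 0 < kappa &
  forall (t : R) (u' : Cspace d r), 0 <= t ->
    Cdist N u' u < kappa -> N (f t u' - f t u) < eta.

Definition Cbounded (R : realType) (d : nat) (r : R) (N : 'rV[R]_d -> R)
    (B : set (Cspace d r)) : Prop :=
  exists M : R, forall u, B u -> Cnorm N u <= M.

Definition bounded_on_bounded (R : realType) (d : nat) (r : R)
    (N : 'rV[R]_d -> R) (f : R -> Cspace d r -> 'rV[R]_d) : Prop :=
  forall B : set (Cspace d r), Cbounded N B ->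
  exists K : R, forall t u, 0 <= t -> B u -> N (f t u) <= K.

Definition time_average (R : realType) (d : nat) (g : R -> 'rV[R]_d) (T : R) :
    'rV[R]_d :=
  T^-1 *: \row_i Rintegral (@lebesgue_measure R) `[0, T] (fun t => g t 0 i).

Definition is_segment (R : realType) (d : nat) (r : R) (x : R -> 'rV[R]_d)
    (t : R) (u : Cspace d r) : Prop :=
  forall theta : set_type `[- r, 0]%classic, u theta = x (t + set_val theta).

(* Derivative relative to [A]: one-sided at an endpoint of an interval [A]. *)
Definition has_derivative_within (R : realType) (d : nat) (A : set R)
    (x : R -> 'rV[R]_d) (t : R) (v : 'rV[R]_d) : Prop :=
  (s - t)^-1 *: (x s - x t) @[s --> within A t^'] --> v.

(* A function on an interval starting at [- r]: only the values of [x] on [J]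
   matter. The interval may or may not contain its right end, but must extend
   to the right of [0]. *)
Definition starting_interval (R : realType) (r : R) (J : set R) : Prop :=
  [/\ is_interval J, J (- r), J `<=` `[- r, +oo[ & exists2 b, 0 < b & J b].

Definition is_solution (R : realType) (d : nat) (r : R)
    (g : R -> Cspace d r -> 'rV[R]_d) (phi : Cspace d r)
    (x : R -> 'rV[R]_d) (J : set R) : Prop :=
  [/\ starting_interval r J,
      {within J, continuous x},
      is_segment x 0 phi &
      forall t, J t -> 0 <= t -> exists2 u : Cspace d r, is_segment x t u &
        has_derivative_within (J `&` `[0, +oo[) x t (g t u)].

Definition is_restriction (R : realType) (d : nat)
    (x : R -> 'rV[R]_d) (J : set R) (z : R -> 'rV[R]_d) (K : set R) : Prop :=
  J `<=` K /\ forall t, J t -> x t = z t.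

Definition is_maximal_solution (R : realType) (d : nat) (r : R)
    (g : R -> Cspace d r -> 'rV[R]_d) (phi : Cspace d r)
    (x : R -> 'rV[R]_d) (J : set R) : Prop :=
  is_solution g phi x J /\
  forall z K, is_solution g phi z K -> is_restriction x J z K -> K = J.

(* The uniqueness of the maximal solution is contained in the second clause. *)
Definition is_unique_solution (R : realType) (d : nat) (r : R)
    (g : R -> Cspace d r -> 'rV[R]_d) (phi : Cspace d r)
    (x : R -> 'rV[R]_d) (J : set R) : Prop :=
  is_maximal_solution g phi x J /\
  forall z K, is_solution g phi z K -> is_restriction z K x J.

(* Main.v *)
(* Compactness argument. If the claim failed, there would be eps_n -> 0 and
   solutions x_n of the fast problem leaving the delta-tube around y, for the
   first time at t_n <= L. Stopped at t_n they are equi-Lipschitz, so along an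
   ultrafilter on nat they converge uniformly to some z, and t_n -> b. Near a
   time t0, with u = z_{t0}, (H1) allows one to replace f(s / eps_n, (x_n)_s) by
   f(s / eps_n, u), whose primitive eps_n * int_0^(s / eps_n) f(., u) tends to
   s * F u by (H3); the mean value inequality then says that F u is the
   derivative of z at t0. Thus z solves the averaged problem on [-r, b] and
   agrees with y by (H6), contradicting |x_n(t_n) - y(t_n)| >= delta. That a
   maximal solution staying in the tube reaches L is the continuation theorem,
   whose two ingredients (closing the interval of existence and Peano's theorem
   with Euler polygons) are obtained from the same limit lemma. *)
Require Import Defs.
From HB Require Import structures.
From mathcomp Require Import all_boot all_order all_algebra.
From mathcomp Require Import all_classical all_reals all_analysis.
From mathcomp Require Import lra.
Set Implicit Arguments.
Unset Strict Implicit.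
Unset Printing Implicit Defensive.
Import Order.TTheory GRing.Theory Num.Theory.
Import numFieldNormedType.Exports.
Local Open Scope classical_set_scope.
Local Open Scope ring_scope.

(** * Mean value inequality for right derivatives *)

Lemma continuous_epsP (R : realType) (V : normedModType R) (w : R -> V) :
  continuous w <-> forall (t e : R), 0 < e -> exists2 rho : R, 0 < rho &
    forall s : R, `|s - t| < rho -> `|w s - w t| < e.
Proof.
split=> [cw t e e0|H t].
  have /cvgrPdist_lt /(_ e e0) := cw t.
  move/nbhs_ballP => [rho /= rho0 Hr]; exists rho => // s st.
  by rewrite distrC; apply: Hr; rewrite /ball /= distrC.
apply/cvgrPdist_lt => e /(H t) [rho rho0 Hr].
apply/nbhs_ballP; exists rho => //= s; rewrite /ball /= distrC => /Hr.
by rewrite distrC.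
Qed.

(** Supremum argument: the times in [[a, b]] at which the bound holds have a supremum [c].
    Continuity puts [c] in the set, and the local hypothesis at [c] moves past it unless [c = b]. *)
Lemma mean_value_local (R : realType) (V : normedModType R) (w : R -> V)
    (a b eta : R) :
  a <= b -> 0 <= eta -> continuous w ->
  (forall t : R, a <= t -> t < b -> exists2 rho : R, 0 < rho &
     forall s : R, t <= s -> s < t + rho -> `|w s - w t| <= eta * (s - t)) ->
  `|w b - w a| <= eta * (b - a).
Proof.
move=> ab eta0 /continuous_epsP cw H.
pose S := [set t | (a <= t <= b) && (`|w t - w a| <= eta * (t - a))].
have Sa : S a by rewrite /S /= lexx ab !subrr normr0 mulr0 lexx.
have Sub : ubound S b by move=> t /andP[/andP[]].
have hS : has_sup S by split; [exists a | exists b].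
have acS : a <= sup S by apply: ub_le_sup => //; exists b.
have cbS : sup S <= b by apply: ge_sup => //; exists a.
set c := sup S in acS cbS.
have Sc : `|w c - w a| <= eta * (c - a).
  apply/ler_addgt0Pr => e e0.
  have [rho rho0 Hr] := cw c e e0.
  have [t /andP[/andP[at_ tb]] wt ct] := sup_adherent rho0 hS.
  have tc : t <= c by apply: ub_le_sup; [exists b | rewrite /S /= at_ tb].
  have wtc : `|w t - w c| < e.
    by apply: Hr; rewrite distrC ger0_norm ?subr_ge0// /c; lra.
  rewrite -(subrKA (w t)) (le_trans (ler_normD _ _))// addrC lerD//.
    rewrite (le_trans wt)// ler_wpM2l//; lra.
  by rewrite distrC ltW.
case: (ltrP c b) => [cb|bc]; last by have <- : c = b by lra.
have [rho rho0 Hr] := H c acS cb.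
(* A point strictly beyond [c], still in [[a, b]] and in the range of the local bound at [c]; it
   belongs to [S], which contradicts the choice of [c]. *)
pose s := Num.min b (c + rho / 2).
have cs : c < s by rewrite /s lt_min cb; lra.
have sr : s < c + rho by rewrite /s gt_min; apply/orP; right; lra.
have sb : s <= b by rewrite /s ge_min lexx.
have : S s.
  rewrite /S /= sb (le_trans acS (ltW cs)) /=.
  rewrite -(subrKA (w c)) (le_trans (ler_normD _ _))//.
  have := Hr s (ltW cs) sr; lra.
move=> /(ub_le_sup (ex_intro _ b Sub)); rewrite -/c => sc; lra.
Qed.

(** The quotient is multiplied out, so [s = t] needs no exclusion. One side is enough for the mean
    value inequality and tolerates the kinks of Euler polygons. *)
Definition right_derivative (R : realType) (V : normedModType R) (X : R -> V)
    (t : R) (v : V) : Prop :=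
  forall eta : R, 0 < eta -> exists2 rho : R, 0 < rho &
    forall s : R, t <= s -> s < t + rho ->
      `|X s - X t - (s - t) *: v| <= eta * (s - t).

Lemma right_derivative_local (R : realType) (V : normedModType R)
    (X Y : R -> V) (t rho : R) (v : V) :
  0 < rho -> (forall s : R, t <= s -> s < t + rho -> X s = Y s) ->
  right_derivative X t v -> right_derivative Y t v.
Proof.
move=> rho0 XY Xv eta /Xv[rho' rho'0 Hr].
exists (Num.min rho rho'); first by rewrite lt_min rho0.
move=> s ts st; have [sr sr'] : s < t + rho /\ s < t + rho'.
  by move: st; rewrite addr_minr lt_min => /andP[].
by rewrite -!XY// ?ltrDl//; exact: Hr.
Qed.

Lemma mean_value (R : realType) (V : normedModType R) (X : R -> V)
    (a b eta : R) :
  a <= b -> 0 <= eta -> continuous X ->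
  (forall t : R, a <= t -> t < b -> exists2 v, `|v| <= eta & right_derivative X t v) ->
  `|X b - X a| <= eta * (b - a).
Proof.
move=> ab eta0 cX H; apply/ler_addgt0Pr => e e0.
(* Room for the remainder in the definition of the derivative; the [+ 1] keeps the denominator
   positive when [a = b]. *)
pose e' := e / (b - a + 1).
have ba1 : 0 < b - a + 1 by lra.
have e'0 : 0 < e' by rewrite divr_gt0.
have := @mean_value_local _ _ X a b (eta + e') ab _ cX.
have -> : 0 <= eta + e' by lra.
move=> /(_ isT) K; apply: le_trans (K _) _.
  move=> t at_ tb; have [v vle Xv] := H t at_ tb.
  have [rho rho0 Hr] := Xv e' e'0; exists rho => // s ts st.
  rewrite -(subrK ((s - t) *: v) (X s - X t)) (le_trans (ler_normD _ _))//.
  rewrite mulrDl addrC lerD// ?Hr// normrZ ger0_norm ?subr_ge0// mulrC.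
  by rewrite ler_wpM2r// subr_ge0.
rewrite mulrDl lerD2l /e' mulrAC ler_pdivrMr//.
by rewrite ler_wpM2l//; lra.
Qed.

Lemma subr_subACA (V : zmodType) (a b c e : V) :
  a - b - (c - e) = a - c - (b - e).
Proof. by rewrite !opprB addrACA [RHS]addrACA [- b - c]addrC. Qed.

Lemma right_derivativeB (R : realType) (V : normedModType R) (X Y : R -> V)
    (t : R) (v p : V) :
  right_derivative X t v -> right_derivative Y t p ->
  right_derivative (fun s => X s - Y s) t (v - p).
Proof.
move=> Xv Yp eta eta0.
have eta2 : 0 < eta / 2 by lra.
have [r1 r10 H1] := Xv _ eta2; have [r2 r20 H2] := Yp _ eta2.
exists (Num.min r1 r2); first by rewrite lt_min r10.
move=> s ts st; have [sr1 sr2] : s < t + r1 /\ s < t + r2.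
  by move: st; rewrite addr_minr lt_min => /andP[].
have -> : X s - Y s - (X t - Y t) - (s - t) *: (v - p) =
    (X s - X t - (s - t) *: v) - (Y s - Y t - (s - t) *: p).
  by rewrite scalerBr (subr_subACA (X s)) (subr_subACA (X s - X t)).
rewrite (le_trans (ler_normB _ _))//.
have := H1 s ts sr1; have := H2 s ts sr2; lra.
Qed.

(** * Histories and ultrafilter limits *)

(* The history x_t of a continuous x; the zero function when x is not continuous
   on the window. *)
Definition segment_at (R : realType) (d : nat) (r : R) (x : R -> 'rV[R]_d)
    (t : R) : Cspace d r :=
  match pselect (continuous (fun theta : set_type `[- r, 0]%classic =>
    x (t + set_val theta))) with
  | left c => mkcts c
  | right _ => cst 0
  end.

Lemma segment_atP (R : realType) (d : nat) (r : R) (x : R -> 'rV[R]_d) (t : R) :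
  continuous x -> is_segment x t (segment_at r x t).
Proof.
move=> cx; rewrite /segment_at; case: pselect => //= -[].
move=> theta; apply: (@continuous_comp _ _ _ (fun th => t + set_val th) x).
  apply: continuousD; first exact: cst_continuous.
  exact: (@initial_continuous _ R set_val).
exact: cx.
Qed.

Lemma is_segment_unique (R : realType) (d : nat) (r : R) (x : R -> 'rV[R]_d)
    (t : R) (u v : Cspace d r) :
  is_segment x t u -> is_segment x t v -> u = v.
Proof. by move=> xu xv; apply/continuousEP => th; rewrite xu xv. Qed.

Lemma set_val_itv (R : realType) (r : R) (theta : set_type `[- r, 0]%classic) :
  - r <= set_val theta <= 0.
Proof. by case: theta => th; rewrite /set_val /= inE /= in_itv. Qed.

Lemma eq_is_segment (R : realType) (d : nat) (r : R) (x y : R -> 'rV[R]_d)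
    (t : R) (u : Cspace d r) :
  (forall s : R, t - r <= s <= t -> x s = y s) ->
  is_segment x t u -> is_segment y t u.
Proof.
move=> xy xu th; rewrite xu xy//.
by have /andP[] := set_val_itv th; lra.
Qed.

Lemma eq_segment_at (R : realType) (d : nat) (r : R) (x y : R -> 'rV[R]_d)
    (t : R) : continuous x -> continuous y ->
  (forall s : R, t - r <= s <= t -> x s = y s) ->
  segment_at r x t = segment_at r y t.
Proof.
move=> cx cy xy; apply: (@is_segment_unique _ _ _ y t).
  by apply: (eq_is_segment xy); exact: segment_atP.
exact: segment_atP.
Qed.

Lemma ultra_fmap (T T' : Type) (g : T -> T') (U : set_system T) :
  UltraFilter U -> UltraFilter (g @ U).
Proof.
move=> UU; split=> [|G PG UG]; first exact: fmap_proper_filter.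
apply/seteqP; split=> // A GA.
have [//|UA] := in_ultra_setVsetC (g @^-1` A) UU.
have /UG GC : (g @ U) (~` A) by [].
by case: (@filter_not_empty _ G PG); rewrite -(setICr A); exact: filterI.
Qed.

Lemma ultra_compact_cvg (I : Type) (T : topologicalType) (U : set_system I)
    (A : set T) (g : I -> T) :
  UltraFilter U -> compact A -> (forall i, A (g i)) ->
  exists2 p, A p & g @ U --> p.
Proof.
move=> UU; rewrite compact_ultra => cA Ag.
have [|p [Ap gp]] := cA (g @ U) (ultra_fmap g UU); last by exists p.
by apply: nearW.
Qed.

(** This is the continuity of the history map from [t] to [z_t] in the supremum norm: compactness of
    the window makes the pointwise continuity of [z] uniform in [th]. *)
Lemma segment_equicontinuous (R : realType) (V : normedModType R) (r : R)
    (z : R -> V) (t : R) (e : R) : continuous z -> 0 < e ->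
  exists2 rho : R, 0 < rho & forall s : R, `|s - t| < rho ->
    forall th : R, - r <= th <= 0 -> `|z (s + th) - z (t + th)| < e.
Proof.
move=> cz e0.
have cK : compact `[- r, 0]%classic by exact: segment_compact.
move/compact_near_coveringP/near_covering_withinP: cK => cov.
have : \forall s \near t, `[- r, 0]%classic `<=`
    (fun th => `|z (s + th) - z (t + th)| < e).
  apply: (cov R (nbhs t) (fun s th => `|z (s + th) - z (t + th)| < e)) => th _.
  have e2 : 0 < e / 2 by rewrite divr_gt0.
  have [rho rho0 Hr] := (continuous_epsP z).1 cz (t + th) (e / 2) e2.
  have rho2 : 0 < rho / 2 by rewrite divr_gt0.
  exists (ball th (rho / 2), ball t (rho / 2)); first by split; exact: nbhsx_ballx.
  move=> [q s] [/= Bq Bs] _; rewrite /ball /= in Bq Bs.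
  rewrite -(subrKA (z (t + th))) (le_lt_trans (ler_normD _ _))//.
  have q1 : `|t + q - (t + th)| < rho.
    have -> : t + q - (t + th) = - (th - q) by lra.
    by rewrite normrN; lra.
  have q2 : `|s + q - (t + th)| < rho.
    have -> : s + q - (t + th) = - ((t - s) + (th - q)) by lra.
    by rewrite normrN; have := ler_normD (t - s) (th - q); lra.
  have := Hr _ q1; have := Hr _ q2; rewrite [`|z (t + th) - _|]distrC; lra.
move=> /nbhs_ballP[rho /= rho0 Hr]; exists rho => // s st th thr.
by apply: Hr; rewrite /ball /= ?in_itv//= distrC.
Qed.

Lemma compact_norm_le (R : realType) (d : nat) (M : R) :
  compact [set v : 'rV[R]_d | `|v| <= M].
Proof.
apply: bounded_closed_compact.
  exists M; split; first exact: num_real.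
  by move=> x Mx v /= vM; rewrite (le_trans vM)// ltW.
apply: (@preimage_closed _ _ (fun v : 'rV[R]_d => `|v|) [set x | x <= M]).
  by move=> v _; exact: norm_continuous.
exact: closed_le.
Qed.

Lemma normB_max_le (R : realDomainType) (s t c : R) :
  `|Num.max s c - Num.max t c| <= `|s - t|.
Proof.
have := ler_norm (s - t); have := ler_norm (t - s); rewrite [`|t - s|]distrC.
have := normr_ge0 (s - t); rewrite ler_norml.
by case: (lerP s c) => ?; case: (lerP t c) => ?; move=> *; apply/andP; split; lra.
Qed.

Lemma normB_min_le (R : realDomainType) (s t c : R) :
  `|Num.min s c - Num.min t c| <= `|s - t|.
Proof.
have := ler_norm (s - t); have := ler_norm (t - s); rewrite [`|t - s|]distrC.
have := normr_ge0 (s - t); rewrite ler_norml.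
by case: (lerP s c) => ?; case: (lerP t c) => ?; move=> *; apply/andP; split; lra.
Qed.

(* Arzela-Ascoli along an ultrafilter, which replaces the extraction of
   subsequences. *)
Lemma equilipschitz_ultra_limit (R : realType) (d : nat) (U : set_system nat)
    (X : nat -> R -> 'rV[R]_d) (phi : R -> 'rV[R]_d) (K : R) :
  UltraFilter U -> 0 <= K -> continuous phi ->
  (forall n (t : R), t <= 0 -> X n t = phi t) ->
  (forall n (s t : R), 0 <= s -> 0 <= t -> `|X n t - X n s| <= K * `|t - s|) ->
  exists z : R -> 'rV[R]_d, [/\ continuous z, forall t : R, t <= 0 -> z t = phi t &
    forall c e : R, 0 < e ->
      \forall n \near U, forall t : R, t <= c -> `|X n t - z t| < e].
Proof.
move=> UU K0 cphi Xphi XK.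
have [z Xz] : {z : R -> 'rV[R]_d & forall t, X n t @[n --> U] --> z t}.
  apply: (@choice _ _ (fun t p => X n t @[n --> U] --> p)) => t.
  (* A bound on [X n t] independent of [n]: the first term alone serves for [t <= 0], and for
     [t > 0] the Lipschitz growth from [phi 0] is added. *)
  pose M := `|phi (Num.min t 0)| + K * `|t|.
  have cA := @compact_norm_le R d M.
  have [n|p _ Xp] := @ultra_compact_cvg _ _ U _ (X ^~ t) UU cA; last by exists p.
  rewrite /M /=; have [t0|t0] := lerP t 0.
    by rewrite Xphi// lerDl mulr_ge0.
  rewrite -[X n t](subrK (X n 0)) (le_trans (ler_normD _ _))// addrC.
  rewrite (Xphi n 0)// lerD2l; have := XK n 0 t (lexx _) (ltW t0).
  by rewrite (Xphi n 0)// subr0.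
have near_lt (t e : R) : 0 < e -> \forall n \near U, `|X n t - z t| < e.
  by move=> e0; have /cvgrPdist_lt/(_ e e0) := Xz t; apply: filterS => n; rewrite distrC.
have zphi (t : R) : t <= 0 -> z t = phi t.
  move=> t0; apply/eqP; rewrite -subr_eq0 -normr_le0; apply/ler_addgt0Pr => e e0.
  rewrite add0r; have /filter_ex[n] := near_lt t e e0.
  by rewrite Xphi// distrC => /ltW.
have zK (s t : R) : 0 <= s -> 0 <= t -> `|z t - z s| <= K * `|t - s|.
  move=> s0 t0; apply/ler_addgt0Pr => e e0.
  have e2 : 0 < e / 2 by rewrite divr_gt0.
  have [n [A B]] : exists n, `|X n s - z s| < e / 2 /\ `|X n t - z t| < e / 2.
    by apply: (@filter_ex _ U); apply: filterI; exact: near_lt.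
  have := XK n s t s0 t0.
  have := ler_normD (z t - X n t) (X n t - X n s).
  have := ler_normD (z t - X n t + (X n t - X n s)) (X n s - z s).
  rewrite !subrKA [`|z t - X n t|]distrC; lra.
have cz : continuous z.
  (* Writing [z] as the initial function plus a Lipschitz part avoids gluing at 0. *)
  have zE t : z t = phi (Num.min t 0) + (z (Num.max t 0) - z 0).
    have [t0|t0] := lerP t 0; first by rewrite subrr addr0 zphi.
    by rewrite (zphi 0)// addrC subrK.
  apply/continuous_epsP => t e e0.
  have e2 : 0 < e / 2 by rewrite divr_gt0.
  have [rho rho0 Hr] := (continuous_epsP phi).1 cphi (Num.min t 0) _ e2.
  exists (Num.min rho (e / 2 / (K + 1))).
    by rewrite lt_min rho0 divr_gt0//; lra.
  move=> s; rewrite lt_min => /andP[sr sK].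
  have ms : `|Num.min s 0 - Num.min t 0| <= `|s - t|.
    exact: normB_min_le.
  have Ms : `|Num.max s 0 - Num.max t 0| <= `|s - t|.
    exact: normB_max_le.
  rewrite (zE s) (zE t) opprD addrACA (le_lt_trans (ler_normD _ _))//.
  have A := Hr _ (le_lt_trans ms sr).
  rewrite opprB subrKA.
  have B : `|z (Num.max s 0) - z (Num.max t 0)| <= K * `|s - t|.
    apply: le_trans (zK _ _ _ _) _; rewrite ?le_max ?lexx ?orbT//.
    exact: ler_wpM2l.
  move: sK; rewrite ltr_pdivlMr; last by lra.
  have := normr_ge0 (s - t); nra.
exists z; split=> // c e e0.
(* Pointwise convergence becomes uniform on [[0, c]]: near each [t], the increments of [X n] and of
   [z] and the error at [t] are each below [e / 4]. To the left of 0 the functions coincide. *)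
have cK : compact `[0, c]%classic by exact: segment_compact.
move/compact_near_coveringP/near_covering_withinP: cK => cov.
have : \forall n \near U, `[0, c]%classic `<=` (fun t => `|X n t - z t| < e).
  apply: (cov nat U (fun n t => `|X n t - z t| < e)) => t.
  rewrite /= in_itv /= => /andP[t0 tc].
  have e4 : 0 < e / 4 by rewrite divr_gt0.
  have e4K : 0 < e / 4 / (K + 1) by rewrite divr_gt0//; lra.
  exists (ball t (e / 4 / (K + 1)), [set n | `|X n t - z t| < e / 4]).
    by split; [exact: nbhsx_ballx|exact: near_lt].
  move=> [q n] [/= Bq Bn]; rewrite in_itv /= => /andP[q0 qc]; rewrite /ball /= in Bq.
  have := XK n t q t0 q0; have := zK q t q0 t0.
  have := ler_normD (X n q - X n t) (X n t - z t).
  have := ler_normD (X n q - X n t + (X n t - z t)) (z t - z q).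
  rewrite !subrKA; move: Bq; rewrite ltr_pdivlMr; last by lra.
  rewrite [`|q - t|]distrC; have := normr_ge0 (t - q); nra.
apply: filterS => n Hn t tc; have [t0|t0] := lerP t 0.
  by rewrite Xphi// zphi// subrr normr0.
by apply: Hn; rewrite /= in_itv /= tc ltW.
Qed.

(** * Differentiating limits of approximate solutions *)

Lemma has_derivative_withinP (R : realType) (d : nat) (A : set R)
    (x : R -> 'rV[R]_d) (t : R) (v : 'rV[R]_d) :
  has_derivative_within A x t v <->
  forall eta : R, 0 < eta -> exists2 rho : R, 0 < rho &
    forall s : R, A s -> `|s - t| < rho ->
      `|x s - x t - (s - t) *: v| <= eta * `|s - t|.
Proof.
have E (s eta : R) : s != t ->
    (`|v - (s - t)^-1 *: (x s - x t)| <= eta) =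
    (`|x s - x t - (s - t) *: v| <= eta * `|s - t|).
  move=> st; have st0 : s - t != 0 by rewrite subr_eq0.
  have -> : x s - x t - (s - t) *: v =
      - ((s - t) *: (v - (s - t)^-1 *: (x s - x t))).
    by rewrite scalerBr scalerA divff// scale1r opprB.
  by rewrite normrN normrZ mulrC ler_pM2r// normr_gt0.
split=> [/cvgrPdist_le H eta eta0|H].
  have /nbhs_ballP[rho /= rho0 Hr] := H eta eta0.
  exists rho => // s As st; have [->|nst] := eqVneq s t.
    by rewrite subrr subrr scale0r subr0 !normr0 mulr0.
  by rewrite -E//; apply: Hr => //; rewrite /ball /= distrC.
apply/cvgrPdist_le => eta /H[rho rho0 Hr].
apply/nbhs_ballP; exists rho => //= s; rewrite /ball /= distrC => st nst As.
by rewrite E//; exact: Hr.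
Qed.

Lemma lipschitz_of_right_derivative (R : realType) (V : normedModType R)
    (X : R -> V) (b K : R) :
  0 <= K -> continuous X -> (forall t : R, b <= t -> X t = X b) ->
  (forall t : R, 0 <= t -> t < b ->
     exists2 v, `|v| <= K & right_derivative X t v) ->
  forall s t : R, 0 <= s -> 0 <= t -> `|X t - X s| <= K * `|t - s|.
Proof.
move=> K0 cX Xb XK s t s0 t0.
wlog st : s t s0 t0 / s <= t.
  move=> H; have /orP[st|ts] := le_total s t; first exact: H.
  by rewrite distrC [`|t - s|]distrC; exact: H.
rewrite [X in _ <= _ * X]ger0_norm ?subr_ge0//.
have [bs|sb] := lerP b s.
  by rewrite (Xb s bs) (Xb t (le_trans bs st)) subrr normr0 mulr_ge0// subr_ge0.
have [tb|bt] := lerP t b.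
  apply: mean_value => // p sp pt; apply: XK; first exact: le_trans sp.
  exact: lt_le_trans tb.
rewrite (Xb t (ltW bt)); apply: (@le_trans _ _ (K * (b - s))).
  apply: mean_value => //; first exact: ltW.
  by move=> p sp pb; apply: XK => //; exact: le_trans sp.
by rewrite ler_wpM2l// lerD2r ltW.
Qed.

(* [X n] follows the field [g n] with a delay of at most [h n] until it is stopped
   at [bn n]. [D n] is a primitive in time of [g n] frozen near the state [u], and
   its limit, of slope [v t0 u], dictates the derivative of the limit of [X n].
   Averaging takes h = 0 and D n a rescaled integral of f(., u); for Euler
   polygons h is the step and D n is linear. *)
Lemma limit_of_approximate_solutions (R : realType) (d : nat) (r : R)
    (U : set_system nat) (g : nat -> R -> Cspace d r -> 'rV[R]_d)
    (v : R -> Cspace d r -> 'rV[R]_d) (X : nat -> R -> 'rV[R]_d)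
    (phi : R -> 'rV[R]_d) (K b : R) (bn h : nat -> R) :
  UltraFilter U -> 0 <= r -> 0 <= K -> 0 <= b ->
  bn @ U --> b -> h @ U --> 0 -> continuous phi ->
  (forall n, continuous (X n)) ->
  (forall n (t : R), t <= 0 -> X n t = phi t) ->
  (forall n (t : R), bn n <= t -> X n t = X n (bn n)) ->
  (forall n (t : R), 0 <= t -> t < bn n -> exists tau : R,
     [/\ 0 <= tau <= t, t - tau <= h n,
         `|g n tau (segment_at r (X n) tau)| <= K &
         right_derivative (X n) t (g n tau (segment_at r (X n) tau))]) ->
  (forall (t0 : R) (u : Cspace d r) (eta : R), 0 <= t0 <= b -> 0 < eta ->
     exists (kappa : R) (D : nat -> R -> 'rV[R]_d),
     [/\ 0 < kappa, forall s : R, 0 <= s -> D n s @[n --> U] --> s *: v t0 u,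
         forall n, continuous (D n) &
         forall n (t tau : R) (u' : Cspace d r), 0 <= tau <= t -> t - tau <= h n ->
           `|t - t0| < kappa -> `|tau - t0| < kappa ->
           (forall th, `|u' th - u th| < kappa) ->
           exists2 p, right_derivative (D n) t p & `|g n tau u' - p| <= eta]) ->
  exists z : R -> 'rV[R]_d,
  [/\ continuous z, forall t : R, t <= 0 -> z t = phi t,
      forall e : R, 0 < e ->
        \forall n \near U, forall t : R, t <= b + 1 -> `|X n t - z t| < e &
      forall t : R, 0 <= t <= b ->
        has_derivative_within `[0, b] z t (v t (segment_at r z t))].
Proof.
move=> UU r0 K0 b0 bnb h0 cphi cX Xphi Xbn XD HD.
have XK n (s t : R) : 0 <= s -> 0 <= t -> `|X n t - X n s| <= K * `|t - s|.
  apply: lipschitz_of_right_derivative (Xbn n) _ s t => //.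
  by move=> t t0 tb; have [tau [_ _ gK Xt]] := XD n t t0 tb; exists (g n tau (segment_at r (X n) tau)).
have [z [cz zphi Xz]] := equilipschitz_ultra_limit UU K0 cphi Xphi XK.
exists z; split=> //; first by move=> e; exact: Xz.
move=> t0 t0b; apply/has_derivative_withinP => eta eta0.
set u := segment_at r z t0.
have uE th : u th = z (t0 + set_val th) by exact: segment_atP.
have [kappa [D [kappa0 Dlim cD HDn]]] := HD t0 u eta t0b eta0.
have k2 : 0 < kappa / 2 by rewrite divr_gt0.
have [rho rho0 Hrho] := segment_equicontinuous r t0 cz k2.
(* Halved because the delayed time [tau] is within [h n < m] of [t], hence within [m * 2] of [t0],
   where both [kappa] and [rho] must still apply. *)
pose m := Num.min 1 (Num.min kappa rho) / 2.
have [m0 m1 mk mr] : [/\ 0 < m, m * 2 <= 1, m * 2 <= kappa & m * 2 <= rho].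
  rewrite /m divfK// !ge_min !lexx ?orbT; split=> //.
  by rewrite divr_gt0// !lt_min ltr01 kappa0.
(* On [[s1, s2)] the right derivatives of [X n - D n] are bounded by [eta], so the mean value
   inequality holds for [U]-almost all [n] and passes to the limit. The strict [s2 < b] ensures that
   [X n] is not yet stopped. *)
have est (s1 s2 : R) : 0 <= s1 -> s1 <= s2 -> s2 < b ->
    `|s1 - t0| < m -> `|s2 - t0| < m ->
    `|z s2 - z s1 - (s2 - s1) *: v t0 u| <= eta * (s2 - s1).
  move=> s10 s12 s2b s1m s2m.
  have s20 := le_trans s10 s12.
  have incr : \forall n \near U,
      `|(X n s2 - D n s2) - (X n s1 - D n s1)| <= eta * (s2 - s1).
    near=> n.
    have s2bn : s2 < bn n by near: n; apply: (cvgr_gt b).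
    have hm : h n < m by near: n; apply: (cvgr_lt 0).
    have Xzn (t : R) : t <= b + 1 -> `|X n t - z t| < kappa / 2.
      by move: t; near: n; exact: Xz.
    apply: (@mean_value _ _ (fun s => X n s - D n s)) => //; first exact: ltW.
      by move=> s; apply: continuousB; [exact: cX|exact: cD].
    move=> t s1t ts2.
    have t00 : 0 <= t := le_trans s10 s1t.
    have tbn : t < bn n := lt_trans ts2 s2bn.
    have [tau [/andP[tau0 taut] tauh _ Xt]] := XD n t t00 tbn.
    have tm : `|t - t0| < m.
      move: s1m s2m; rewrite !ltr_norml => /andP[s1l _] /andP[_ s2r].
      by apply/andP; split; clear -s1l s2r s1t ts2; lra.
    have taum : `|tau - t0| < m * 2.
      move: tm; rewrite !ltr_norml => /andP[tl tr].
      by apply/andP; split; clear -tl tr tauh hm taut; lra.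
    have [|||||p Dp gp] := HDn n t tau (segment_at r (X n) tau).
    - by rewrite tau0.
    - exact: tauh.
    - by clear -tm mk m0; lra.
    - exact: lt_le_trans taum mk.
    (* The history of [X n] at [tau] is within [kappa / 2] of that of [z] by uniform convergence,
       and the latter within [kappa / 2] of [u] by continuity of the history map. *)
    - move=> th; rewrite segment_atP// uE.
      have /andP[th1 th2] := set_val_itv th.
      rewrite -(subrKA (z (tau + set_val th))) (le_lt_trans (ler_normD _ _))//.
      rewrite [ltRHS]splitr ltrD//.
        by apply: Xzn; clear -taut ts2 s2b th2; lra.
      by apply: Hrho; [exact: lt_le_trans taum mr|exact: set_val_itv].
    by exists (g n tau (segment_at r (X n) tau) - p) => //; exact: right_derivativeB.
  have lim : (X n s2 - D n s2) - (X n s1 - D n s1) @[n --> U] -->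
      (z s2 - s2 *: v t0 u) - (z s1 - s1 *: v t0 u).
    have Xlim (s : R) : X n s @[n --> U] --> z s.
      apply/cvgrPdist_lt => e e0; apply: filterS (Xz s e e0) => n.
      by rewrite distrC; apply.
    by apply: cvgB; apply: cvgB; [exact: Xlim|exact: Dlim|exact: Xlim|exact: Dlim].
  have -> : z s2 - z s1 - (s2 - s1) *: v t0 u =
      (z s2 - s2 *: v t0 u) - (z s1 - s1 *: v t0 u).
    by rewrite scalerBl subr_subACA.
  exact: cvgr_to_le (cvg_norm lim) incr.
(* The stopping times [bn n] may lie below [b], so the endpoint [s2 = b] is reached as a limit from
   the left. *)
have est' (s1 s2 : R) : 0 <= s1 -> s1 <= s2 -> s2 <= b ->
    `|s1 - t0| < m -> `|s2 - t0| < m ->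
    `|z s2 - z s1 - (s2 - s1) *: v t0 u| <= eta * (s2 - s1).
  move=> s10 s12; rewrite le_eqVlt => /predU1P[s2b|]; last exact: est.
  rewrite {}s2b in s12 *.
  move: s12; rewrite le_eqVlt => /predU1P[-> _ _|s1b s1m bm].
    by rewrite !subrr scale0r subr0 normr0 mulr0.
  rewrite -subr_le0.
  pose G (s : R) := `|z s - z s1 - (s - s1) *: v t0 u| - eta * (s - s1).
  have Gb : G @ b^'- --> G b.
    apply: cvg_at_left_filter; rewrite /G.
    apply: cvgB.
      apply: cvg_norm; apply: cvgB; first by apply: cvgB; [exact: cz|exact: cvg_cst].
      by apply: cvgZr_tmp; apply: cvgB; [exact: cvg_id|exact: cvg_cst].
    by apply: cvgMr; apply: cvgB; [exact: cvg_id|exact: cvg_cst].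
  apply: (cvgr_to_le Gb); near=> s.
  have sb : s < b by near: s; exact: nbhs_left_lt.
  have s1s : s1 < s by near: s; exact: nbhs_left_gt.
  have t0s : t0 - m < s.
    near: s; apply: nbhs_left_gt.
    by move: bm; rewrite ltr_norml => /andP[]; lra.
  rewrite /G subr_le0; apply: est => //; first exact: ltW.
  have := bm; rewrite !ltr_norml => /andP[_ bm'].
  by apply/andP; split; clear -bm' t0s sb; lra.
exists m => // s; rewrite /= in_itv /= => /andP[s0 sb] sm.
have tm : `|t0 - t0| < m by rewrite subrr normr0.
case/andP: t0b => t00 t0b; have [ts|st] := lerP t0 s.
  exact: est'.
(* For [s < t0] the estimate is applied with [t0] as right endpoint; the derivative is thus
   two-sided inside [[0, b]]. *)
have -> : z s - z t0 - (s - t0) *: v t0 u = - (z t0 - z s - (t0 - s) *: v t0 u).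
  by rewrite opprB -[t0 - s]opprB scaleNr -[z t0 - z s]opprB opprK addrC.
by rewrite normrN; apply: est' => //; exact: ltW.
Unshelve. all: by end_near.
Qed.

(** * Solutions as functions on the whole line *)

Lemma within_continuous_epsP (R : realType) (V : normedModType R) (A : set R)
    (x : R -> V) :
  {within A, continuous x} <-> forall t e : R, A t -> 0 < e ->
    exists2 rho : R, 0 < rho &
    forall s : R, A s -> `|s - t| < rho -> `|x s - x t| < e.
Proof.
rewrite subspace_continuousP; split=> [H t e At e0|H t At].
  have /cvgrPdist_lt/(_ e e0)/nbhs_ballP[rho /= rho0 Hr] := H t At.
  exists rho => // s As st; rewrite distrC; apply: Hr => //.
  by rewrite /ball /= distrC.
apply/cvgrPdist_lt => e /(H t e At)[rho rho0 Hr].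
apply/nbhs_ballP; exists rho => //= s; rewrite /ball /= distrC => st As.
by rewrite distrC; exact: Hr.
Qed.

(** The projection onto [[a, b]]: composing with it extends a function on [[a, b]] to the whole line
    by its end values. *)
Definition clamp (R : realDomainType) (a b t : R) : R :=
  Num.max (Num.min t b) a.

Lemma clamp_itv (R : realDomainType) (a b t : R) :
  a <= b -> a <= clamp a b t <= b.
Proof. by move=> ab; rewrite /clamp le_max lexx orbT ge_max ge_min lexx orbT ab. Qed.

Lemma clamp_id (R : realDomainType) (a b t : R) :
  a <= t -> t <= b -> clamp a b t = t.
Proof. by move=> at_ tb; rewrite /clamp min_l// max_l. Qed.

Lemma clamp_ge (R : realDomainType) (a b t : R) :
  a <= b -> b <= t -> clamp a b t = b.
Proof. by move=> ab bt; rewrite /clamp min_r// max_l. Qed.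

Lemma continuous_clamp (R : realType) (V : normedModType R) (x : R -> V)
    (a b : R) : a <= b -> {within `[a, b], continuous x} ->
  continuous (fun t => x (clamp a b t)).
Proof.
move=> ab /within_continuous_epsP cx; apply/continuous_epsP => t e e0.
have H (s : R) : `[a, b]%classic (clamp a b s) by rewrite /= in_itv /= clamp_itv.
have [rho rho0 Hr] := cx _ e (H t) e0; exists rho => // s st.
apply: Hr => //; apply: le_lt_trans st.
exact: le_trans (normB_max_le _ _ _) (normB_min_le _ _ _).
Qed.

Lemma eq_segment_within (R : realType) (d : nat) (r : R) (X Y : R -> 'rV[R]_d)
    (b t : R) : continuous X -> continuous Y ->
  (forall s : R, s <= b -> X s = Y s) -> t <= b ->
  segment_at r X t = segment_at r Y t.
Proof.
move=> cX cY XY tb; apply: eq_segment_at => // s /andP[_ st].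
by apply: XY; exact: le_trans tb.
Qed.

Section solutions.
Context {R : realType} {d : nat} {r : R}.
Implicit Types (g : R -> Cspace d r -> 'rV[R]_d) (phi : Cspace d r)
  (x X : R -> 'rV[R]_d) (J : set R).

Lemma solution_itv g phi x J b : 0 <= r -> is_solution g phi x J -> J b ->
  `[- r, b] `<=` J.
Proof.
move=> r0 [[iJ Jr _ _] _ _ _] Jb t; rewrite /= in_itv /= => tb.
exact: iJ tb.
Qed.

Lemma clamp_solution_continuous g phi x J b : 0 <= r ->
  is_solution g phi x J -> J b -> - r <= b ->
  continuous (fun t => x (clamp (- r) b t)).
Proof.
move=> r0 sx Jb rb; apply: continuous_clamp => //.
by case: (sx) => _ cx _ _; apply: continuous_subspaceW cx; exact: solution_itv sx Jb.
Qed.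

Lemma clamp_solution_right_derivative g phi x J b t : 0 <= r ->
  is_solution g phi x J -> J b -> 0 <= t -> t < b ->
  let X := fun s => x (clamp (- r) b s) in
  right_derivative X t (g t (segment_at r X t)).
Proof.
move=> r0 sx Jb t0 tb X.
have rb : - r <= b by lra.
have JJ := solution_itv r0 sx Jb.
have Jt : J t by apply: JJ; rewrite /= in_itv /=; apply/andP; split; lra.
have XE s : - r <= s -> s <= b -> X s = x s by move=> ? ?; rewrite /X clamp_id.
have cX : continuous X := clamp_solution_continuous r0 sx Jb rb.
have [_ _ _ /(_ t Jt t0)[u xu /has_derivative_withinP xt]] := sx.
have -> : segment_at r X t = u.
  apply: (@is_segment_unique _ _ _ X t); first exact: segment_atP.
  by apply: eq_is_segment xu => s /andP[rs st]; rewrite XE//; lra.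
(* Staying within [b - t] keeps [s] below [b], where the clamped function is still [x]. *)
move=> eta /xt[rho rho0 Hr]; exists (Num.min rho (b - t)).
  by rewrite lt_min rho0 subr_gt0.
move=> s ts; rewrite addr_minr lt_min => /andP[sr sb].
have sb' : s <= b by lra.
rewrite !XE//; try lra.
have := Hr s; rewrite (ger0_norm (_ : 0 <= s - t)) ?subr_ge0//; apply.
- split; first by apply: JJ; rewrite /= in_itv /=; apply/andP; split; lra.
  by rewrite /= in_itv /= andbT (le_trans t0).
- by lra.
Qed.

Lemma total_solution g phi X b : 0 <= r -> 0 < b -> continuous X ->
  is_segment X 0 phi ->
  (forall t, 0 <= t <= b ->
     has_derivative_within `[0, b] X t (g t (segment_at r X t))) ->
  is_solution g phi X `[- r, b].
Proof.
move=> r0 b0 cX X0 HX; split => //.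
- split.
  + exact: interval_is_interval.
  + by rewrite /= in_itv /= lexx /=; lra.
  + by move=> t; rewrite /= !in_itv /= => /andP[->].
  + by exists b => //; rewrite /= in_itv /= lexx andbT; lra.
- exact: continuous_subspaceT.
- move=> t; rewrite /= in_itv /= => /andP[rt tb] t0.
  exists (segment_at r X t); first exact: segment_atP.
  suff -> : `[- r, b] `&` `[0, +oo[ = `[0, b]%classic by apply: HX; rewrite t0.
  apply/seteqP; split=> s; rewrite /= !in_itv /= ?andbT.
    by move=> [/andP[_ ->] ->].
  by move=> /andP[s0 ->]; rewrite s0 andbT; split=> //; lra.
Qed.

(** * Euler polygons *)

Lemma right_derivative_affine (a v : 'rV[R]_d) (c t : R) :
  right_derivative (fun s => a + (s - c) *: v) t v.
Proof.
move=> eta eta0; exists 1 => // s ts _.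
rewrite opprD addrACA subrr add0r -scalerBl.
have -> : s - c - (t - c) = s - t by lra.
by rewrite subrr normr0 mulr_ge0 ?subr_ge0// ltW.
Qed.

(** Each induction step appends one linear piece of length [h], with slope given by the field at the
    last node [tm]. Since the field sees only the past, the derivatives found earlier are not
    disturbed; on the new piece [tau] is the node [tm]. *)
Lemma euler_polygon g X0 (w h : R) (m : nat) : 0 <= w -> 0 < h ->
  continuous X0 -> (forall t, w <= t -> X0 t = X0 w) ->
  (forall t, 0 <= t -> t < w -> right_derivative X0 t (g t (segment_at r X0 t))) ->
  exists X, [/\ continuous X, forall t, t <= w -> X t = X0 t,
    forall t, w + h * m%:R <= t -> X t = X (w + h * m%:R) &
    forall t, 0 <= t -> t < w + h * m%:R -> exists tau,
      [/\ 0 <= tau <= t, t - tau <= h &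
          right_derivative X t (g tau (segment_at r X tau))]].
Proof.
move=> w0 h0 cX0 X0w X0D.
elim: m => [|m [X [cX XX0 Xc XD]]].
  exists X0; rewrite mulr0 addr0; split=> // t t0 tw.
  by exists t; split; [rewrite t0 lexx|rewrite subrr ltW|exact: X0D].
have hm0 : 0 <= h * m%:R by rewrite mulr_ge0// ltW.
set tm := w + h * m%:R in Xc XD.
have -> : w + h * m.+1%:R = tm + h by rewrite /tm -addn1 natrD mulrDr mulr1 addrA.
have wtm : w <= tm by rewrite lerDl.
clearbody tm => {hm0}.
set v := g tm (segment_at r X tm).
(* The factor of [v] is a ramp: 0 before [tm], then [t - tm], then constantly [h]. As [X] is frozen
   after [tm], this single formula gives the new piece and freezes it at [tm + h]. *)
pose Y t := X t + Num.max (Num.min (t - tm) h) 0 *: v.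
have YX t : t <= tm -> Y t = X t.
  by move=> ttm; rewrite /Y max_r ?scale0r ?addr0// ge_min; apply/orP; left; lra.
have YL t : tm <= t -> t <= tm + h -> Y t = X tm + (t - tm) *: v.
  by move=> t1 t2; rewrite /Y Xc// min_l ?max_l//; lra.
have cY : continuous Y.
  apply/continuous_epsP => t e e0.
  have e2 : 0 < e / 2 by rewrite divr_gt0.
  have [rho rho0 Hr] := (continuous_epsP X).1 cX t _ e2.
  have v0 := normr_ge0 v.
  exists (Num.min rho (e / 2 / (`|v| + 1))).
    by rewrite lt_min rho0 divr_gt0//; lra.
  move=> s; rewrite lt_min => /andP[sr sK].
  rewrite /Y [X in `|X|](_ : _ = (X s - X t) + (Num.max (Num.min (s - tm) h) 0 -
    Num.max (Num.min (t - tm) h) 0) *: v); last first.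
    by rewrite scalerBl addrACA -opprD.
  rewrite (le_lt_trans (ler_normD _ _))// normrZ.
  have A := Hr _ sr.
  have B : `|Num.max (Num.min (s - tm) h) 0 - Num.max (Num.min (t - tm) h) 0|
      <= `|s - t|.
    apply: le_trans (normB_max_le _ _ _) _; apply: le_trans (normB_min_le _ _ _) _.
    by rewrite opprB subrKA.
  have C := ler_wpM2r v0 B.
  move: sK; rewrite ltr_pdivlMr; last by lra.
  have := normr_ge0 (s - t); clear -A C; nra.
exists Y; split=> //.
- by move=> t tw; rewrite YX ?XX0// (le_trans tw).
- move=> t tt; have tmt : tm <= t by lra.
  rewrite (YL (tm + h)) ?lexx ?lerDl ?(ltW h0)//.
  have -> : tm + h - tm = h by lra.
  by rewrite /Y Xc// min_r ?max_l ?(ltW h0)//; clear -tt; lra.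
- move=> t t0 tt; have [ttm|tmt] := ltP t tm.
    have [tau [/andP[tau0 taut] th Xt]] := XD t t0 ttm.
    exists tau; split; [by rewrite tau0|exact: th|].
    rewrite (eq_segment_within r cY cX YX (le_trans taut (ltW ttm))).
    apply: (@right_derivative_local _ _ X Y t (tm - t)) Xt.
      by rewrite subr_gt0.
    by move=> s _ sl; rewrite YX//; clear -sl; lra.
  exists tm; split.
  + by rewrite tmt (le_trans w0).
  + by clear -tt; lra.
  + rewrite (eq_segment_within r cY cX YX (lexx tm)) -/v.
    apply: (@right_derivative_local _ _ (fun s => X tm + (s - tm) *: v) _ _ (tm + h - t)).
    * by clear -tt; lra.
    * by move=> s ts st; rewrite YL//; clear -ts st tmt; lra.
    * exact: right_derivative_affine.
Qed.

End solutions.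

(** * Continuation of solutions *)

(** Applied to an ultrafilter refining [\oo], along which ordinary limits of sequences persist. *)
Lemma cvg_finer (T : topologicalType) (F U : set_system nat) (g : nat -> T)
    (l : T) : F `<=` U -> g @ F --> l -> g @ U --> l.
Proof. by move=> FU gl A /gl; exact: FU. Qed.

Lemma continuous_bounded_itv (R : realType) (V : normedModType R) (X : R -> V)
    (a b : R) : continuous X -> exists M : R, forall t, a <= t <= b -> `|X t| <= M.
Proof.
move=> cX.
have /compact_bounded : compact (X @` `[a, b]).
  by apply: continuous_compact; [exact: continuous_subspaceT|exact: segment_compact].
move=> [M [_ HM]]; exists (M + 1) => t tab; apply: (HM (M + 1)).
  by rewrite ltrDl.
by exists t.
Qed.

Section continuation.
Context {R : realType} {d : nat} {r : R}.
Implicit Types (g : R -> Cspace d r -> 'rV[R]_d) (phi : Cspace d r)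
  (x X : R -> 'rV[R]_d) (J : set R) (u : Cspace d r).

(** Closeness of states is expressed pointwise and in the library norm, which keeps both the
    supremum and the arbitrary norm out of the compactness arguments. *)
Definition continuous_field g := forall (t : R) u, 0 <= t ->
  forall eta : R, 0 < eta -> exists2 kappa : R, 0 < kappa &
  forall (t' : R) (u' : Cspace d r), 0 <= t' -> `|t' - t| < kappa ->
    (forall th, `|u' th - u th| < kappa) -> `|g t' u' - g t u| < eta.

Definition bounded_field g := forall M : R, exists2 K : R, 0 <= K &
  forall (t : R) u, 0 <= t -> (forall th, `|u th| <= M) -> `|g t u| <= K.

(** The limit lemma for a field independent of [n]: by continuity of [g] at [(t0, u)], the linear
    function of slope [g t0 u] can serve as every [D n]. *)
Lemma solution_of_approximations g (U : set_system nat) (X : nat -> R -> 'rV[R]_d)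
    (phi0 : R -> 'rV[R]_d) (K b : R) (bn h : nat -> R) :
  continuous_field g ->
  UltraFilter U -> 0 <= r -> 0 <= K -> 0 <= b ->
  bn @ U --> b -> h @ U --> 0 -> continuous phi0 ->
  (forall n, continuous (X n)) ->
  (forall n (t : R), t <= 0 -> X n t = phi0 t) ->
  (forall n (t : R), bn n <= t -> X n t = X n (bn n)) ->
  (forall n (t : R), 0 <= t -> t < bn n -> exists tau : R,
     [/\ 0 <= tau <= t, t - tau <= h n,
         `|g tau (segment_at r (X n) tau)| <= K &
         right_derivative (X n) t (g tau (segment_at r (X n) tau))]) ->
  exists z : R -> 'rV[R]_d,
  [/\ continuous z, forall t : R, t <= 0 -> z t = phi0 t,
      forall e : R, 0 < e ->
        \forall n \near U, forall t : R, t <= b + 1 -> `|X n t - z t| < e &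
      forall t : R, 0 <= t <= b ->
        has_derivative_within `[0, b] z t (g t (segment_at r z t))].
Proof.
move=> cg UU r0 K0 b0 bnb h0 cphi cX Xphi Xbn XD.
apply: (limit_of_approximate_solutions UU r0 K0 b0 bnb h0 cphi cX Xphi Xbn XD).
move=> t0 u eta /andP[t00 t0b] eta0.
have [kappa kappa0 Hk] := cg t0 u t00 eta eta0.
exists kappa, (fun n s => 0 + (s - 0) *: g t0 u); split=> //.
- by move=> s s0; rewrite add0r subr0; exact: cvg_cst.
- move=> n s; apply: cvgD; first exact: cvg_cst.
  by apply: cvgZr_tmp; apply: cvgB; [exact: cvg_id|exact: cvg_cst].
- move=> n t tau u' /andP[tau0 _] _ _ taut0 u'u.
  exists (g t0 u); first exact: right_derivative_affine.
  exact/ltW/(Hk tau u').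
Qed.

(** Stopping [x] at times increasing to [w] gives equi-Lipschitz approximations without delay; their
    limit agrees with [x] before [w] and is differentiable up to [w]. *)
Lemma solution_closure g phi x J (w M : R) :
  continuous_field g -> bounded_field g -> 0 <= r -> 0 < w ->
  is_solution g phi x J -> (forall t, J t = (- r <= t < w) :> Prop) ->
  (forall t, J t -> 0 <= t -> `|x t| <= M) ->
  exists2 z, is_solution g phi z `[- r, w] & forall t, J t -> x t = z t.
Proof.
move=> cg bg r0 w0 sx JE xM.
have [U [UU ooU]] := @ultraFilterLemma nat \oo _.
(* As [harmonic n] is [1 / (n + 1)], these times start at 0 and stay below [w]. *)
pose a n := w - w * harmonic n.
have aw n : 0 <= a n < w.
  rewrite /a subr_ge0 ltrBlDr ltrDl mulr_gt0 ?invr_gt0 ?ltr0n// andbT.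
  by rewrite ler_piMr ?(ltW w0)// invf_le1 ?ltr0n// ler1n.
have Ja n : J (a n).
  by rewrite JE; have /andP[a0 ->] := aw n; rewrite andbT (le_trans _ a0)// oppr_le0.
have J0 : J 0 by rewrite JE w0 andbT oppr_le0.
have ra n : - r <= a n.
  by have /andP[a0 _] := aw n; rewrite (le_trans _ a0)// oppr_le0.
have aU : a @ U --> w.
  apply: (cvg_finer ooU); rewrite -[X in _ --> X]subr0 -(mulr0 w).
  apply: cvgB; first exact: cvg_cst.
  by apply: cvgMr; exact: cvg_harmonic.
have rr : - r <= 0 by rewrite oppr_le0.
pose phi0 t := x (clamp (- r) 0 t).
have cphi0 : continuous phi0 := clamp_solution_continuous r0 sx J0 rr.
pose X n t := x (clamp (- r) (a n) t).
have cX n : continuous (X n) := clamp_solution_continuous r0 sx (Ja n) (ra n).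
have [M0 HM0] := continuous_bounded_itv (- r) 0 cphi0.
(* The bound [M] covers times from 0 on; the initial history needs its own bound [M0]. *)
have xM' t : - r <= t < w -> `|x t| <= Num.max M M0.
  move=> tw; rewrite le_max; have [t0|/ltW t0] := leP 0 t.
    by rewrite xM// JE.
  have /andP[rt _] := tw; have := HM0 t; rewrite rt t0 => /(_ isT).
  by rewrite /phi0 clamp_id// => ->; rewrite orbT.
have [K K0 HK] := bg (Num.max M M0).
have XM n s : `|X n s| <= Num.max M M0.
  apply: xM'; have /andP[-> ca] := clamp_itv s (ra n).
  by rewrite (le_lt_trans ca)//; have /andP[] := aw n.
have [|||z [cz z0 Xz Dz]] := @solution_of_approximations g U X phi0 K w a
    (fun=> 0) cg UU r0 K0 (ltW w0) aU (cvg_cst _) cphi0 cX.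
- move=> n t t0; have /andP[a0 _] := aw n.
  by rewrite /X /phi0 /clamp min_l ?(le_trans t0)// min_l.
- by move=> n t at_; rewrite /X !clamp_ge.
- move=> n t t0 ta; exists t; split; [by rewrite t0 lexx|by rewrite subrr| |].
    by apply: (HK _ _ t0) => th; rewrite segment_atP; [exact: XM|exact: cX].
  exact: (clamp_solution_right_derivative r0 sx (Ja n)).
have xz t : J t -> x t = z t.
  rewrite JE => /andP[rt tw]; apply/eqP; rewrite -subr_eq0 -normr_le0.
  apply/ler_addgt0Pr => e e0; rewrite add0r.
  have [n [Xn tn]] : exists n, (forall t : R, t <= w + 1 -> `|X n t - z t| < e) /\
      t < a n.
    apply: (@filter_ex _ U); apply: filterI; first exact: Xz.
    exact: (cvgr_gt w).
  have := Xn t; rewrite /X clamp_id// ?(ltW tn)// => H; apply/ltW/H.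
  by clear -tw; lra.
exists z => //; apply: total_solution => //.
move=> th; have /andP[th1 th2] := set_val_itv th.
have [_ _ /(_ th) -> _] := sx; rewrite add0r z0// /phi0 clamp_id//.
Qed.

Lemma peano_continuation g phi x J (w : R) :
  continuous_field g -> bounded_field g -> 0 <= r -> 0 < w ->
  is_solution g phi x J -> (forall t, J t = (- r <= t <= w) :> Prop) ->
  exists z (w' : R), [/\ w < w', is_solution g phi z `[- r, w'] &
    forall t, J t -> x t = z t].
Proof.
move=> cg bg r0 w0 sx JE.
have [U [UU ooU]] := @ultraFilterLemma nat \oo _.
have rr : - r <= 0 by rewrite oppr_le0.
have rw : - r <= w by rewrite (le_trans rr)// ltW.
have Jw : J w by rewrite JE lexx rw.
pose X0 t := x (clamp (- r) w t).
have cX0 : continuous X0 := clamp_solution_continuous r0 sx Jw rw.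
have X0x t : - r <= t -> t <= w -> X0 t = x t by move=> ? ?; rewrite /X0 clamp_id.
have X0w t : w <= t -> X0 t = X0 w by move=> wt; rewrite /X0 !clamp_ge.
have [M0 HM0] := continuous_bounded_itv (- r) w cX0.
pose M := M0 + 1.
have [K K0 HK] := bg M.
(* The truncated field makes the Euler polygons K-Lipschitz a priori; up to time
   w + T they stay below M, where the truncation is inactive. *)
pose g' t u := if `[< 0 <= t /\ forall th, `|u th| <= M >] then g t u else 0.
have g'K t u : `|g' t u| <= K.
  rewrite /g'; case: asboolP => [[t0 uM]|_]; first exact: HK.
  by rewrite normr0.
have g'g t u : 0 <= t -> (forall th, `|u th| <= M) -> g' t u = g t u.
  by move=> t0 uM; rewrite /g'; case: asboolP => // -[].
(* In time [T] a [K]-Lipschitz curve moves by at most [K * T <= 1], the margin between [M0] and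
   [M]. *)
pose T := (K + 1)^-1.
have T0 : 0 < T by rewrite invr_gt0; lra.
have KT : K * T <= 1 by rewrite /T ler_pdivrMr; lra.
(* With this mesh, [n.+1] Euler steps cover exactly the length [T]. *)
pose h n := T * harmonic n.
have h0 n : 0 < h n by rewrite mulr_gt0// invr_gt0 ltr0n.
have hT n : h n * n.+1%:R = T by rewrite /h -mulrA mulVf ?mulr1// pnatr_eq0.
have hU : h @ U --> 0.
  apply: (cvg_finer ooU); rewrite -(mulr0 T).
  by apply: cvgMr; exact: cvg_harmonic.
have X0D t : 0 <= t -> t < w -> right_derivative X0 t (g' t (segment_at r X0 t)).
  move=> t0 tw; rewrite g'g//.
    exact: (clamp_solution_right_derivative r0 sx Jw).
  move=> th; rewrite segment_atP//; have /andP[th1 th2] := set_val_itv th.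
  apply: le_trans (HM0 _ _) _; last by rewrite lerDl.
  by apply/andP; clear -t0 tw th1 th2; split; lra.
have XP n := @euler_polygon R d r g' X0 w (h n) n.+1 (ltW w0) (h0 n) cX0 X0w X0D.
have {XP} [X HX] := choice XP.
have {}HX n : [/\ continuous (X n), forall t, t <= w -> X n t = X0 t,
    forall t, w + T <= t -> X n t = X n (w + T) &
    forall t, 0 <= t -> t < w + T -> exists tau,
      [/\ 0 <= tau <= t, t - tau <= h n &
          right_derivative (X n) t (g' tau (segment_at r (X n) tau))]].
  by have := HX n; rewrite hT.
have XM n t : - r <= t -> `|X n t| <= M.
  have [cX XX0 Xc XD] := HX n.
  move=> rt; have [tw|wt] := leP t w.
    by rewrite XX0// (le_trans (HM0 _ _)) ?rt// lerDl.
  rewrite -(subrK (X n w) (X n t)) (le_trans (ler_normD _ _))// addrC.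
  rewrite lerD//; first by rewrite XX0// HM0// rw lexx.
  have XK : forall s t : R, 0 <= s -> 0 <= t -> `|X n t - X n s| <= K * `|t - s|.
    apply: (lipschitz_of_right_derivative K0 cX Xc) => s s0 sT.
    have [tau [_ _ Xs]] := XD s s0 sT.
    by exists (g' tau (segment_at r (X n) tau)).
  have XK' s : w <= s -> s <= w + T -> `|X n s - X n w| <= 1.
    move=> ws sT; have := XK w s (ltW w0) (le_trans (ltW w0) ws).
    rewrite (ger0_norm (_ : 0 <= s - w)) ?subr_ge0// => H.
    apply: (le_trans H); apply: le_trans KT; rewrite ler_wpM2l//.
    by clear -sT; lra.
  have [tT|/ltW Tt] := leP t (w + T); first by apply: XK' => //; exact: ltW.
  by rewrite Xc// XK' ?lerDl ?(ltW T0).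
have wT0 : 0 < w + T by rewrite addr_gt0.
have [||||z [cz z0 Xz Dz]] := @solution_of_approximations g U X X0 K (w + T) (fun=> w + T)
    h cg UU r0 K0 (ltW wT0) (cvg_cst _) hU cX0.
- by move=> n; have [] := HX n.
- by move=> n t t0; have [_ XX0 _ _] := HX n; rewrite XX0// (le_trans t0)// ltW.
- by move=> n; have [] := HX n.
- move=> n t t0 tT; have [cX _ _ /(_ t t0 tT)[tau [tau0t tauh]]] := HX n.
  rewrite g'g; last 2 first.
  + by case/andP: tau0t.
  + move=> th; rewrite segment_atP// XM//; case/andP: tau0t => tau0 _.
    by have /andP[th1 _] := set_val_itv th; clear -tau0 th1; lra.
  move=> Xt; exists tau; split=> //; apply: HK; first by case/andP: tau0t.
  move=> th; rewrite segment_atP// XM//; case/andP: tau0t => tau0 _.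
  by have /andP[th1 _] := set_val_itv th; clear -tau0 th1; lra.
exists z, (w + T); split; first by rewrite ltrDl.
- apply: total_solution => //.
  move=> th; have /andP[th1 th2] := set_val_itv th.
  have [_ _ /(_ th) -> _] := sx; rewrite add0r z0// X0x//.
  by rewrite (le_trans th2)// ltW.
- move=> t; rewrite JE => /andP[rt tw]; apply/eqP; rewrite -subr_eq0 -normr_le0.
  apply/ler_addgt0Pr => e e0; rewrite add0r.
  have [n Xn] : exists n, (forall t : R, t <= w + T + 1 -> `|X n t - z t| < e).
    by apply: (@filter_ex _ U); exact: Xz.
  have := Xn t; have [_ XX0 _ _] := HX n; rewrite XX0// X0x// => H; apply/ltW/H.
  by clear -tw T0; lra.
Qed.

(** If [J] stopped before [L], then with [w = sup J] it would be [[- r, w]], which Peano's theorem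
    extends, or [[- r, w)], which can be closed since [x] is bounded. Either contradicts
    maximality. *)
Lemma maximal_solution_continuation g phi x J (L M : R) :
  continuous_field g -> bounded_field g -> 0 <= r ->
  is_maximal_solution g phi x J ->
  (forall t, J t -> 0 <= t -> t <= L -> `|x t| <= M) -> J L \/ L < - r.
Proof.
move=> cg bg r0 [sx maxx] xM.
have [[iJ Jr Jsub [b b0 Jb]] _ _ _] := sx.
have [?|rL] := ltP L (- r); [by right|left].
apply: contrapT => nJL.
have JL t : J t -> t < L.
  move=> Jt; rewrite ltNge; apply/negP => Lt; apply: nJL.
  by apply: (iJ _ _ Jr Jt); rewrite rL.
have supJ : has_sup J by split; [exists b|exists L => t /JL/ltW].
pose w := sup J.
have Jw t : J t -> t <= w by move=> Jt; apply: ub_le_sup => //; exists L => s /JL/ltW.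
have w0 : 0 < w := lt_le_trans b0 (Jw b Jb).
have Jrw t : - r <= t -> t < w -> J t.
  move=> rt tw; have e0 : 0 < w - t by rewrite subr_gt0.
  have [s Js ts] := sup_adherent e0 supJ.
  apply: (iJ _ _ Jr Js); rewrite rt /= ltW//.
  by move: ts; rewrite opprB addrC subrK.
have Jge t : J t -> - r <= t by move=> /Jsub; rewrite /= in_itv /= andbT.
have xM' t : J t -> 0 <= t -> `|x t| <= M by move=> Jt t0; apply: xM => //; exact/ltW/JL.
have [JJw|nJw] := pselect (J w).
  have JE t : J t = (- r <= t <= w) :> Prop.
    apply/propext; split=> [Jt|/andP[rt]]; first by rewrite Jge// Jw.
    by rewrite le_eqVlt => /predU1P[->//|]; exact: Jrw.
  have [z [w' [ww' sz xz]]] := peano_continuation cg bg r0 w0 sx JE.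
  have Jw'E : `[- r, w']%classic = J.
    apply: (maxx z) => //; split=> // t; rewrite JE /= in_itv /= => /andP[-> tw].
    by rewrite (le_trans tw)// ltW.
  have : J w'.
    rewrite -Jw'E /= in_itv /= lexx andbT.
    by rewrite (le_trans _ (ltW ww'))// Jge.
  by move=> /Jw; rewrite leNgt ww'.
have JE t : J t = (- r <= t < w) :> Prop.
  apply/propext; split=> [Jt|/andP[]]; last exact: Jrw.
  rewrite Jge// lt_neqAle Jw// andbT; apply/negP => /eqP tw.
  by apply: nJw; rewrite -tw.
have [z sz xz] := solution_closure cg bg r0 w0 sx JE xM'.
have JwE : `[- r, w]%classic = J.
  apply: (maxx z) => //; split=> // t; rewrite JE /= in_itv /= => /andP[-> tw].
  by rewrite ltW.
apply: nJw; rewrite -JwE /= in_itv /= lexx andbT.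
by rewrite (le_trans _ (ltW w0))// oppr_le0.
Qed.

End continuation.

(** * Norms and primitives on row vectors *)

Lemma row_norm_le (R : realType) (d : nat) (x : 'rV[R]_d) (e : R) :
  0 <= e -> (forall i, `|x 0 i| <= e) -> `|x| <= e.
Proof.
move=> e0 xe; rewrite [`|x|]mx_normrE; apply: bigmax_le => // -[i j] _ /=.
by rewrite (ord1 i).
Qed.

Lemma row_coord_le_norm (R : realType) (d : nat) (x : 'rV[R]_d) i :
  `|x 0 i| <= `|x|.
Proof.
rewrite [leRHS]mx_normrE.
exact: (le_bigmax _ (fun ij => `|x ij.1 ij.2|) (0, i)).
Qed.

(** Expansion in the canonical basis bounds [N] by the library norm and makes it continuous; the
    converse constant is the inverse of the minimum of [N] on the compact unit sphere, positive by
    definiteness. *)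
Lemma norm_equivalence (R : realType) (d : nat) (N : 'rV[R]_d -> R) :
  is_norm N -> exists C : R,
    0 < C /\ forall x, N x <= C * `|x| /\ `|x| <= C * N x.
Proof.
move=> [ND NZ N0].
have N00 : N 0 = 0 by rewrite -(scale0r 0) NZ normr0 mul0r.
have NN x : N (- x) = N x by rewrite -scaleN1r NZ normrN normr1 mul1r.
have Nge0 x : 0 <= N x.
  by have := ND x (- x); rewrite subrr N00 NN -mulr2n pmulrn_lge0.
pose C1 := \sum_(j < d) N (delta_mx 0 j).
have C10 : 0 <= C1 by apply: sumr_ge0.
have NC1 x : N x <= C1 * `|x|.
  rewrite {1}[x]row_sum_delta.
  apply: (@le_trans _ _ (\sum_(j < d) N (x 0 j *: delta_mx 0 j))).
    elim/big_ind2 : _ => [|u a v b Nu Nv|//]; first by rewrite N00.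
    by rewrite (le_trans (ND _ _))// lerD.
  rewrite mulrC mulr_sumr; apply: ler_sum => j _.
  by rewrite NZ ler_wpM2r// row_coord_le_norm.
have cN : continuous N.
  move=> x; apply/(@cvgrPdist_lt _ R^o _ (nbhs x)) => e e0; apply/nbhs_ballP.
  exists (e / (C1 + 1)) => [|y]; first by rewrite /= divr_gt0//; lra.
  rewrite -ball_normE /= ltr_pdivlMr; last by lra.
  move=> xy; have := NC1 (x - y); have := ND (x - y) y; have := ND (y - x) x.
  rewrite !subrK -[y - x]opprB NN => A B D.
  rewrite ltr_norml; have := normr_ge0 (x - y).
  by move=> n0; apply/andP; clear -A B D xy n0; split; lra.
suff [c c0 Hc] : exists2 c, 0 < c & forall x, `|x| <= c * N x.
  exists (C1 + 1 + c); split; first by lra.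
  move=> x; split.
    by rewrite (le_trans (NC1 x))// ler_wpM2r//; lra.
  by rewrite (le_trans (Hc x))// ler_wpM2r//; lra.
have unitN (x : 'rV[R]_d) : x != 0 -> `| `|x|^-1 *: x | = 1.
  by move=> x0; rewrite normrZ normfV normr_id mulVf// normr_eq0.
(* If the unit sphere is empty there is no minimum to take, but then every vector is 0. *)
have [[e e1]|noe] := pselect (exists e : 'rV[R]_d, `|e| = 1); last first.
  exists 1 => // x; rewrite mul1r; have [->|x0] := eqVneq x 0.
    by rewrite normr0 N00.
  by exfalso; apply: noe; exists (`|x|^-1 *: x); exact: unitN.
have cS : compact [set x : 'rV[R]_d | `|x| = 1].
  apply: (@subclosed_compact _ _ [set x : 'rV[R]_d | `|x| <= 1]).
  - apply: (@preimage_closed _ _ (fun v : 'rV[R]_d => `|v|) [set x | x = 1]).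
      by move=> v _; exact: norm_continuous.
    exact: closed_eq.
  - exact: compact_norm_le.
  - by move=> x /= ->.
have [||p pS pmin] := @EVT_min_rV _ _ N _ _ cS.
- by exists e.
- exact: continuous_subspaceT.
have Np0 : 0 < N p.
  rewrite lt_neqAle Nge0 andbT eq_sym; apply/negP => /eqP/N0 p0.
  by move: pS; rewrite inE /= p0 normr0 => /eqP; rewrite eq_sym oner_eq0.
exists (N p)^-1; first by rewrite invr_gt0.
move=> x; have [->|x0] := eqVneq x 0; first by rewrite normr0 N00 mulr0.
have := pmin (`|x|^-1 *: x); rewrite inE /= unitN// => /(_ erefl).
rewrite NZ normfV normr_id ler_pdivlMl ?normr_gt0// => H.
by rewrite ler_pdivlMl// mulrC.
Qed.

Definition primitive (R : realType) (d : nat) (w : R -> 'rV[R]_d) (T : R) :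
    'rV[R]_d :=
  \row_i Rintegral (@lebesgue_measure R) `[0, T] (fun t => w t 0 i).

(** The library norm is the largest coordinate, so it suffices to integrate, in each coordinate, the
    bounds [v 0 i - eta] and [v 0 i + eta] over []t, s]]. *)
Lemma primitive_increment (R : realType) (d : nat) (w : R -> 'rV[R]_d)
    (v : 'rV[R]_d) (t s eta : R) :
  continuous w -> 0 <= t -> t <= s -> 0 <= eta ->
  (forall p : R, t <= p <= s -> `|w p - v| <= eta) ->
  `|primitive w s - primitive w t - (s - t) *: v| <= eta * (s - t).
Proof.
move=> cw t0 ts eta0 H; apply: row_norm_le => [|i].
  by rewrite mulr_ge0// subr_ge0.
have cwi : continuous (fun p => w p 0 i).
  apply/(@continuous_epsP _ R^o) => p e e0.
  have [rho rho0 Hr] := (continuous_epsP w).1 cw p e e0.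
  exists rho => // q /Hr; apply: le_lt_trans.
  by have := row_coord_le_norm (w q - w p) i; rewrite !mxE.
have int (b c : R) (g : R -> R) : continuous g ->
    (@lebesgue_measure R).-integrable `[b, c] (EFin \o g).
  move=> cg; apply: continuous_compact_integrable; first exact: segment_compact.
  exact: continuous_subspaceT.
have int' (g : R -> R) : continuous g ->
    (@lebesgue_measure R).-integrable `]t, s] (EFin \o g).
  move=> cg; apply: integrableS (int t s g cg) => //.
  by move=> p; rewrite /= !in_itv /= => /andP[/ltW -> ->].
rewrite !mxE Rintegral_itvB ?bnd_simp//; last exact: int.
have cstE (k : R) : Rintegral (@lebesgue_measure R) `]t, s] (fun=> k) = k * (s - t).
  rewrite Rintegral_cst//= lebesgue_measure_itv /= lte_fin.
  by case: ltP => // st; rewrite (_ : s = t) ?subrr//; lra.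
have bnd p : `]t, s]%classic p -> v 0 i - eta <= w p 0 i <= v 0 i + eta.
  rewrite /= in_itv /= => /andP[tp ps].
  have := row_coord_le_norm (w p - v) i; rewrite !mxE.
  have := H p; rewrite ps ltW// => /(_ isT) H1 H2.
  by move: (le_trans H2 H1); rewrite ler_distl.
rewrite ler_distl; apply/andP; split.
  rewrite (_ : _ - _ = (v 0 i - eta) * (s - t)); last by lra.
  rewrite -cstE; apply: le_Rintegral => //.
  - by apply: int'; exact: cst_continuous.
  - exact: int'.
  - by move=> p /bnd/andP[].
rewrite (_ : _ + _ = (v 0 i + eta) * (s - t)); last by lra.
rewrite -cstE; apply: le_Rintegral => //.
- exact: int'.
- by apply: int'; exact: cst_continuous.
- by move=> p /bnd/andP[].
Qed.

Lemma primitive0 (R : realType) (d : nat) (w : R -> 'rV[R]_d) :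
  primitive w 0 = 0.
Proof. by apply/rowP => i; rewrite !mxE set_itv1 Rintegral_set1. Qed.

Lemma right_derivative_primitive (R : realType) (d : nat) (w : R -> 'rV[R]_d)
    (t : R) : continuous w -> 0 <= t -> right_derivative (primitive w) t (w t).
Proof.
move=> cw t0 eta eta0.
have [rho rho0 Hr] := (continuous_epsP w).1 cw t eta eta0.
exists rho => // s ts st; apply: primitive_increment => //; first exact: ltW.
move=> p /andP[tp ps]; apply/ltW/Hr; rewrite ger0_norm ?subr_ge0//; lra.
Qed.

(** Within distance 1 of [t] the integrand is bounded by some [M], which makes the primitive
    [M]-Lipschitz there. *)
Lemma continuous_primitive (R : realType) (d : nat) (w : R -> 'rV[R]_d) :
  continuous w -> continuous (fun t : R => primitive w (Num.max t 0)).
Proof.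
move=> cw; apply/continuous_epsP => t e e0.
have [M HM] := continuous_bounded_itv 0 (`|t| + 1) cw.
have M0 : 0 <= M.
  by apply: le_trans (normr_ge0 (w 0)) (HM 0 _); rewrite lexx /= addr_ge0.
have L (p q : R) : 0 <= p -> p <= q -> q <= `|t| + 1 ->
    `|primitive w q - primitive w p| <= M * (q - p).
  move=> p0 pq qt; rewrite -[X in `|X|]subr0 -(scaler0 _ (q - p)).
  apply: primitive_increment => // y /andP[py yq].
  by rewrite subr0 HM// (le_trans p0 py) (le_trans yq).
have L' (p q : R) : 0 <= p -> 0 <= q -> p <= `|t| + 1 -> q <= `|t| + 1 ->
    `|primitive w q - primitive w p| <= M * `|q - p|.
  move=> p0 q0 pt qt; have /orP[pq|qp] := le_total p q.
    by rewrite [X in _ <= _ * X]ger0_norm ?subr_ge0//; exact: L.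
  by rewrite distrC [`|q - p|]distrC [X in _ <= _ * X]ger0_norm ?subr_ge0//; exact: L.
exists (Num.min 1 (e / (M + 1))); first by rewrite lt_min ltr01 divr_gt0//; lra.
move=> s; rewrite lt_min => /andP[s1 sM].
apply: (@le_lt_trans _ _ (M * `|s - t|)).
  apply: le_trans (L' _ _ _ _ _ _) _; rewrite ?le_max ?lexx ?orbT//.
  - by rewrite ge_max (le_trans (ler_norm t)) ?lerDl// addr_ge0.
  - rewrite ge_max addr_ge0// andbT; have := ler_norm t; have := ler_norm (s - t); lra.
  - by rewrite ler_wpM2l// normB_max_le.
move: sM; rewrite ltr_pdivlMr; last by lra.
have := normr_ge0 (s - t); nra.
Qed.

(** * Averaging *)

Lemma Cnorm_le (R : realType) (d : nat) (r : R) (N : 'rV[R]_d -> R)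
    (u : set_type `[- r, 0]%classic -> 'rV[R]_d) (M : R) :
  0 <= r -> (forall th, N (u th) <= M) -> Cnorm N u <= M.
Proof.
move=> r0 uM; apply: ge_sup; last by move=> _ [th _ <-].
have z : (0 : R) \in `[- r, 0]%classic by rewrite inE /= in_itv /= lexx oppr_le0 r0.
by exists (N (u (exist _ 0 z))); exists (exist _ 0 z).
Qed.

(** The supremum of strictly bounded values is only bounded weakly; halving [kappa] restores
    strictness, and [C] converts between the norms. *)
Lemma Cdist_lt (R : realType) (d : nat) (r : R) (N : 'rV[R]_d -> R) (C : R)
    (u u' : Cspace d r) (kappa : R) :
  0 <= r -> 0 < C -> (forall x, N x <= C * `|x|) -> 0 < kappa ->
  (forall th, `|u' th - u th| < kappa / 2 / C) -> Cdist N u' u < kappa.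
Proof.
move=> r0 C0 NC k0 H; apply: (@le_lt_trans _ _ (kappa / 2)); last by lra.
apply: Cnorm_le => // th; apply: le_trans (NC _) _.
by rewrite -ler_pdivlMl// mulrC ltW.
Qed.

Lemma first_exit (R : realType) (V : normedModType R) (X : R -> V) (b c : R) :
  continuous X -> 0 <= b -> c <= `|X b| ->
  exists t : R, [/\ 0 <= t <= b, c <= `|X t| &
    forall s : R, 0 <= s -> s < t -> `|X s| < c].
Proof.
move=> cX b0 cb.
pose A := `[0, b]%classic `&` [set t : R | c <= `|X t|].
have cA : compact A.
  apply: (@subclosed_compact _ _ `[0, b]%classic); last by apply: subIsetl.
    apply: closedI; first exact: itv_closed.
    apply: (@preimage_closed _ _ (fun t => `|X t|) [set x | c <= x]).
      by move=> t _; apply: cvg_norm; exact: cX.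
    exact: closed_ge.
  exact: segment_compact.
have [||t] := @compact_EVT_min _ R id A _ cA.
- by exists b; split; rewrite //= in_itv /= b0 lexx.
- by apply: continuous_subspaceT => t; exact: cvg_id.
rewrite inE => -[/= tb ct] tmin; exists t; split=> //.
move=> s s0 st; rewrite ltNge; apply/negP => cs.
have /tmin : s \in A.
  rewrite inE; split=> //=; rewrite in_itv /= s0 /=.
  by move: tb; rewrite in_itv /= => /andP[_]; apply: le_trans; exact: ltW.
by rewrite leNgt st.
Qed.

Lemma right_derivative_rescale (R : realType) (V : normedModType R) (G : R -> V)
    (e t : R) (v : V) : 0 < e -> right_derivative G (t / e) v ->
  right_derivative (fun s => e *: G (s / e)) t v.
Proof.
move=> e0 Gv eta /Gv[rho rho0 Hr].
exists (e * rho); first by rewrite mulr_gt0.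
have eK p : e * (p / e) = p by rewrite mulrC divfK// gt_eqF.
move=> s ts st.
have -> : e *: G (s / e) - e *: G (t / e) - (s - t) *: v =
    e *: (G (s / e) - G (t / e) - (s / e - t / e) *: v).
  by rewrite !scalerBr scalerA mulrBr !eK.
have -> : eta * (s - t) = e * (eta * (s / e - t / e)).
  by rewrite mulrCA [in RHS](mulrBr e) !eK.
rewrite normrZ gtr0_norm// ler_wpM2l ?(ltW e0)//; apply: Hr.
  by rewrite ler_wpM2r// invr_ge0 ltW.
by rewrite ltr_pdivrMr// mulrDl divfK ?gt_eqF// [rho * e]mulrC.
Qed.

Section averaging.
Context {R : realType} {d : nat} {r : R}.
Implicit Types (f : R -> Cspace d r -> 'rV[R]_d) (u : Cspace d r).

Lemma continuous_field_rescale f (e : R) : 0 < e -> continuous_field f ->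
  continuous_field (fun t => f (t / e)).
Proof.
move=> e0 cf t u t0 eta eta0.
have te0 : 0 <= t / e by rewrite divr_ge0// ltW.
have [k k0 Hk] := cf (t / e) u te0 eta eta0.
(* Division by [e] stretches time differences, hence [k * e] for times; states keep [k]. *)
exists (Num.min k (k * e)); first by rewrite lt_min k0 mulr_gt0.
move=> t' u' t'0; rewrite lt_min => /andP[_ tt'] uu'; apply: Hk.
- by rewrite divr_ge0// ltW.
- by rewrite -mulrBl normrM [X in _ * X]gtr0_norm ?invr_gt0// ltr_pdivrMr.
- by move=> th; have := uu' th; rewrite lt_min => /andP[].
Qed.

Lemma bounded_field_rescale f (e : R) : 0 < e -> bounded_field f ->
  bounded_field (fun t => f (t / e)).
Proof.
move=> e0 bf M; have [K K0 HK] := bf M; exists K => // t u t0.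
by apply: HK; rewrite divr_ge0// ltW.
Qed.

(** Negative times are replaced by 0, since [f] is controlled only from time 0 on. *)
Lemma continuous_field_time f u : continuous_field f ->
  continuous (fun t : R => f (Num.max t 0) u).
Proof.
move=> cf; apply/continuous_epsP => t e e0.
have [|k k0 Hk] := cf (Num.max t 0) u _ e e0; first by rewrite le_max lexx orbT.
exists k => // s st; apply: Hk.
- by rewrite le_max lexx orbT.
- by apply: le_lt_trans st; exact: normB_max_le.
- by move=> th; rewrite subrr normr0.
Qed.

(** For [s > 0] the expression is [s] times the average over [[0, s / e n]], whose length tends to
    infinity. The case [s = 0] is separate because the average divides by the length. *)
Lemma rescaled_primitive_cvg f (F : Cspace d r -> 'rV[R]_d) u
    (U : set_system nat) (e : nat -> R) (s : R) :
  Filter U -> (forall n, 0 < e n) -> e @ U --> 0 -> 0 <= s ->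
  time_average (fun t => f t u) T @[T --> +oo] --> F u ->
  e n *: primitive (fun t => f (Num.max t 0) u) (Num.max (s / e n) 0)
    @[n --> U] --> s *: F u.
Proof.
move=> FU e0 eU; rewrite le_eqVlt => /predU1P[<- _|s0 H].
  rewrite scale0r; under eq_fun do rewrite mul0r maxxx primitive0 scaler0.
  exact: cvg_cst.
have E n : e n *: primitive (fun t => f (Num.max t 0) u) (Num.max (s / e n) 0) =
    s *: time_average (fun t => f t u) (s / e n).
  have se0 : 0 < s / e n by rewrite divr_gt0.
  rewrite max_l ?(ltW se0)// /time_average scalerA invf_div mulrCA divff ?gt_eqF//.
  rewrite mulr1; congr (_ *: _); apply/rowP => i; rewrite !mxE.
  apply: eq_Rintegral => t; rewrite inE /= in_itv /= => /andP[t0 _].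
  by rewrite max_l.
under eq_fun do rewrite E.
suff Hs : s / e n @[n --> U] --> +oo by apply: cvgZl_tmp; exact: (cvg_comp _ _ Hs H).
move=> A [B [_ HB]]; have B1 : 0 < `|B| + 1 by rewrite ltr_wpDl.
have : \forall n \near U, e n < s / (`|B| + 1).
  by apply: (cvgr_lt 0) => //; rewrite divr_gt0.
apply: filterS => n; rewrite ltr_pdivlMr// => Hn; apply: HB.
rewrite ltr_pdivlMr// mulrC; apply: le_lt_trans Hn.
by rewrite ler_wpM2l ?(ltW (e0 n))// (le_trans (ler_norm B))// lerDl.
Qed.

End averaging.

(** * First exit of a maximal solution from a tube *)

Section first_exit_time.
Context {R : realType} {d : nat} {r : R}.
Implicit Types (g : R -> Cspace d r -> 'rV[R]_d) (phi : Cspace d r)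
  (x y : R -> 'rV[R]_d) (J : set R).

Lemma eq_initial phi x y (s : R) :
  is_segment x 0 phi -> is_segment y 0 phi -> - r <= s <= 0 -> x s = y s.
Proof.
move=> xphi yphi rs.
have z : s \in `[- r, 0]%classic by rewrite inE /= in_itv.
have := xphi (exist _ s z); rewrite (yphi (exist _ s z)) add0r.
by rewrite set_valE /= => ->.
Qed.

Lemma solution_bounded g phi x J (b : R) : 0 <= r -> is_solution g phi x J ->
  J b -> - r <= b -> exists M : R, forall t, - r <= t <= b -> `|x t| <= M.
Proof.
move=> r0 sx Jb rb.
have [M HM] := continuous_bounded_itv (- r) b (clamp_solution_continuous r0 sx Jb rb).
by exists M => t /[dup] /HM + /andP[? ?]; rewrite clamp_id.
Qed.

Lemma first_exit_solution g g' phi x y J J' (L delta : R) :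
  continuous_field g -> bounded_field g -> 0 <= r -> 0 <= L ->
  is_maximal_solution g phi x J -> is_solution g' phi y J' -> J' L ->
  (J L -> ~ forall t, 0 <= t -> t <= L -> `|x t - y t| < delta) ->
  exists t : R, [/\ J t, 0 <= t <= L, delta <= `|x t - y t| &
    forall s : R, 0 <= s -> s < t -> `|x s - y s| < delta].
Proof.
move=> cg bg r0 L0 mx sy J'L bad.
have sx := mx.1.
have rL : - r <= L by rewrite (le_trans _ L0)// oppr_le0.
have [My HMy] := solution_bounded r0 sy J'L rL.
(* Were there no such [b], [x] would stay within [delta] of the bounded [y]; the continuation
   theorem would give [J L], against the hypothesis on [x]. *)
have [b [Jb b0 bL db]] : exists b, [/\ J b, 0 <= b, b <= L & delta <= `|x b - y b|].
  apply: contrapT => nob.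
  have near_y t : J t -> 0 <= t -> t <= L -> `|x t - y t| < delta.
    by move=> Jt t0 tL; rewrite ltNge; apply/negP => dt; apply: nob; exists t.
  have xM t : J t -> 0 <= t -> t <= L -> `|x t| <= delta + My.
    move=> Jt t0 tL; rewrite -(subrK (y t) (x t)) (le_trans (ler_normD _ _))//.
    rewrite lerD ?(ltW (near_y _ _ _ _))// HMy// tL andbT.
    by rewrite (le_trans _ t0)// oppr_le0.
  have [JL|] := maximal_solution_continuation cg bg r0 mx xM; last first.
    by rewrite ltNge rL.
  apply: (bad JL) => t t0 tL; apply: near_y => //.
  apply: (solution_itv r0 sx JL); rewrite /= in_itv /= tL andbT.
  by rewrite (le_trans _ t0)// oppr_le0.
have rb : - r <= b by rewrite (le_trans _ b0)// oppr_le0.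
pose X t := x (clamp (- r) b t); pose Y t := y (clamp (- r) L t).
have XE t : 0 <= t -> t <= b -> X t = x t.
  by move=> t0 tb; rewrite /X clamp_id// (le_trans _ t0)// oppr_le0.
have YE t : 0 <= t -> t <= b -> Y t = y t.
  move=> t0 tb; rewrite /Y clamp_id ?(le_trans tb)//.
  by rewrite (le_trans _ t0)// oppr_le0.
have cXY : continuous (fun t => X t - Y t).
  move=> t; apply: cvgB.
    exact: (clamp_solution_continuous r0 sx Jb rb).
  exact: (clamp_solution_continuous r0 sy J'L rL).
have [|t [/andP[t0 tb] dt Ht]] := @first_exit _ _ (fun t => X t - Y t) b delta cXY b0.
  by rewrite XE// YE.
exists t; split.
- apply: (solution_itv r0 sx Jb); rewrite /= in_itv /= tb andbT.
  by rewrite (le_trans _ t0)// oppr_le0.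
- by rewrite t0 (le_trans tb).
- by rewrite -XE// -YE.
- move=> s s0 st; have sb : s <= b by rewrite (le_trans (ltW st)).
  by rewrite -XE// -YE//; exact: Ht.
Qed.

End first_exit_time.

Lemma averaging_limit (R : realType) (d : nat) (r : R)
    (f : R -> Cspace d r -> 'rV[R]_d) (F : Cspace d r -> 'rV[R]_d)
    (phi : Cspace d r) (y : R -> 'rV[R]_d) (J : set R) (L delta : R)
    (e tn : nat -> R) (x : nat -> R -> 'rV[R]_d) (Jx : nat -> set R) :
  0 <= r -> continuous_field f -> bounded_field f ->
  (forall (u : Cspace d r) (eta : R), 0 < eta -> exists2 kappa : R, 0 < kappa &
     forall (t : R) (u' : Cspace d r), 0 <= t ->
       (forall th, `|u' th - u th| < kappa) -> `|f t u' - f t u| < eta) ->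
  (forall u, time_average (fun t => f t u) T @[T --> +oo] --> F u) ->
  is_solution (fun=> F) phi y J ->
  (forall z K, is_solution (fun=> F) phi z K -> is_restriction z K y J) ->
  0 <= L -> J L -> 0 < delta ->
  (forall n, 0 < e n) -> e @ \oo --> 0 ->
  (forall n, is_solution (fun t => f (t / e n)) phi (x n) (Jx n)) ->
  (forall n, [/\ Jx n (tn n), 0 <= tn n <= L,
     delta <= `|x n (tn n) - y (tn n)| &
     forall s : R, 0 <= s -> s < tn n -> `|x n s - y s| < delta]) -> False.
Proof.
move=> r0 cf bf equi av sy uy L0 JL delta0 e0 elim0 sx Htn.
have rr : - r <= 0 by rewrite oppr_le0.
have rL : - r <= L := le_trans rr L0.
have [U [UU ooU]] := @ultraFilterLemma nat \oo _.
have eU : e @ U --> 0 := cvg_finer ooU elim0.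
have J0 : J 0 by apply: (solution_itv r0 sy JL); rewrite /= in_itv /= rr.
have tn0L n : `[0, L]%classic (tn n) by have [_ + _ _] := Htn n; rewrite /= in_itv.
have [b] := ultra_compact_cvg UU (@segment_compact R 0 L) tn0L.
rewrite /= in_itv /= => /andP[b0 bL] tnb.
pose phi0 t := y (clamp (- r) 0 t).
have cphi0 : continuous phi0 := clamp_solution_continuous r0 sy J0 rr.
pose X n t := x n (clamp (- r) (tn n) t).
have tn0 n : 0 <= tn n by have [_ /andP[]] := Htn n.
have tnL n : tn n <= L by have [_ /andP[]] := Htn n.
have Jtn n : Jx n (tn n) by have [] := Htn n.
have rtn n : - r <= tn n := le_trans rr (tn0 n).
have cX n : continuous (X n) := clamp_solution_continuous r0 (sx n) (Jtn n) (rtn n).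
have yphi : is_segment y 0 phi by case: sy.
have xphi n : is_segment (x n) 0 phi by case: (sx n).
have [My HMy] := solution_bounded r0 sy JL rL.
have [K K0 HK] := bf (delta + My).
(* Before its exit time [x n] is within [delta] of [y], and on the initial window it equals [y];
   hence the constant [K] is common to all [n]. *)
have xM n s : - r <= s -> s < tn n -> `|x n s| <= delta + My.
  move=> rs stn; have yM : `|y s| <= My.
    by apply: HMy; rewrite rs (le_trans (ltW stn)).
  have [s0|s0] := ltP s 0.
    have rs0 : - r <= s <= 0 by rewrite rs ltW.
    by rewrite (eq_initial (xphi n) yphi rs0) (le_trans yM)// lerDr ltW.
  rewrite -(subrK (y s) (x n s)) (le_trans (ler_normD _ _))// lerD//.
  by have [_ _ _ /(_ s s0 stn)/ltW] := Htn n.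
have [||||z [cz z0 Xz Dz]] := @limit_of_approximate_solutions R d r U
    (fun n t => f (t / e n)) (fun=> F) X phi0 K b tn (fun=> 0)
    UU r0 K0 b0 tnb (cvg_cst _) cphi0 cX.
- move=> n t t0; rewrite /X /phi0 /clamp (min_l (le_trans t0 (tn0 n))) (min_l t0).
  apply: (eq_initial (xphi n) yphi).
  by rewrite le_max lexx orbT ge_max t0.
- by move=> n t tnt; rewrite /X !clamp_ge.
- move=> n t t0 ttn; exists t.
  split; [by rewrite t0 lexx|by rewrite subrr| |].
    apply: HK; first by rewrite divr_ge0// ltW.
    move=> th; have /andP[th1 th2] := set_val_itv th.
    rewrite segment_atP; last exact: cX.
    have A : - r <= t + set_val th by clear -t0 th1; lra.
    have B : t + set_val th < tn n by clear -ttn th2; lra.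
    by rewrite /X clamp_id ?(ltW B)//; exact: xM.
  exact: (clamp_solution_right_derivative r0 (sx n) (Jtn n) t0 ttn).
- move=> t0 u eta _ eta0.
  have [kappa kappa0 Hk] := equi u eta eta0.
  pose w (t : R) := f (Num.max t 0) u.
  have cw : continuous w := @continuous_field_time _ _ _ f u cf.
  (* The right derivative of this function is [f (t / e n) u]. The uniformity in time of (H1) lets
     one [kappa] serve for all [n]. *)
  exists kappa, (fun n (t : R) => e n *: primitive w (Num.max (t / e n) 0)); split=> //.
  + by move=> s s0; exact: rescaled_primitive_cvg.
  + move=> n s; apply: cvgZl_tmp.
    apply: (@continuous_comp _ _ _ (fun t : R => t / e n)
      (fun t : R => primitive w (Num.max t 0))); last exact: continuous_primitive.
    by apply: cvgMl; exact: cvg_id.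
  + move=> n t tau u' /andP[tau0 taut] ttau _ _ u'u.
    (* The delay is 0. *)
    have {ttau} ttau : tau = t by apply/eqP; rewrite eq_le taut -subr_le0.
    rewrite {}ttau in tau0 taut *.
    have te0 : 0 <= t / e n by rewrite divr_ge0// ltW.
    exists (w (t / e n)); last first.
      by rewrite /w max_l//; apply/ltW/Hk.
    apply: (@right_derivative_local _ _ (fun s => e n *: primitive w (s / e n))
      _ _ 1) => //.
      by move=> s ts _; rewrite max_l// divr_ge0 ?(le_trans tau0 ts)// ltW.
    apply: right_derivative_rescale => //.
    exact: right_derivative_primitive.
have rb : - r <= b := le_trans rr b0.
pose Y t := y (clamp (- r) L t).
have cY : continuous Y := clamp_solution_continuous r0 sy JL rL.
have zb : z b = y b.
  (* For [b = 0] there is no interval to solve on, and the common initial value is used; otherwise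
     uniqueness applies on [[- r, b]]. *)
  move: b0; rewrite le_eqVlt => /predU1P[<-|b0].
    by rewrite z0// /phi0 clamp_id.
  have /uy[_ ->//] : is_solution (fun=> F) phi z `[- r, b].
    apply: total_solution => //.
    move=> th; have /andP[th1 th2] := set_val_itv th.
    by rewrite (yphi th) add0r z0// /phi0 clamp_id.
  by rewrite /= in_itv /= lexx rb.
have YE t : - r <= t -> t <= L -> Y t = y t by move=> ? ?; rewrite /Y clamp_id.
have cZY : continuous (fun t => z t - Y t).
  by move=> t; apply: cvgB; [exact: cz|exact: cY].
have d2 : 0 < delta / 2 by rewrite divr_gt0.
have [rho rho0 Hrho] := (continuous_epsP _).1 cZY b _ d2.
(* At [tn n] the distance from [X n] to [z] and that from [z] to [y] are both below [delta / 2]. The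
   margin [b + 1] is there because [tn n] may exceed [b]. *)
have [n [Xn tnr tn1]] : exists n, [/\ forall t : R, t <= b + 1 -> `|X n t - z t| < delta / 2,
    `|tn n - b| < rho & tn n <= b + 1].
  have : \forall n \near U, (forall t : R, t <= b + 1 -> `|X n t - z t| < delta / 2) /\
    (`|tn n - b| < rho /\ tn n <= b + 1).
    apply: filterI; first exact: Xz.
    apply: filterI.
      move/cvgrPdist_lt : tnb => /(_ rho rho0); apply: filterS => k.
      by rewrite distrC.
    by apply: (cvgr_le b) => //; rewrite ltrDl.
  by move=> /filter_ex[n [A [B D]]]; exists n.
have [_ _ dn _] := Htn n.
have := Hrho _ tnr; rewrite (YE b)// zb subrr subr0 YE//.
have := Xn _ tn1; rewrite /X clamp_id// => A B.
have := ler_normD (x n (tn n) - z (tn n)) (z (tn n) - y (tn n)).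
by rewrite subrKA; clear -A B dn; lra.
Qed.

(** * Passage to the library norm and choice of a sequence of counterexamples *)

Theorem theorem2p8 (R : realType) (d : nat) (hd : (1 <= d)%N) (r : R)
    (hr : 0 <= r) (N : 'rV[R]_d -> R) (hN : is_norm N)
    (f : R -> Cspace d r -> 'rV[R]_d) (hf : continuous_on_Rplus N f)
    (phi : Cspace d r)
    (H1 : equicontinuous_in_state N f)
    (H2 : bounded_on_bounded N f)
    (F : Cspace d r -> 'rV[R]_d)
    (H3 : forall u : Cspace d r,
       time_average (fun t => f t u) T @[T --> +oo] --> F u)
    (y : R -> 'rV[R]_d) (J : set R)
    (H6 : is_unique_solution (fun _ => F) phi y J)
    (L : R) (hLpos : 0 < L) (hLJ : J L) :
  forall delta : R, 0 < delta ->
  exists2 eps0 : R, 0 < eps0 &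
  forall eps : R, 0 < eps -> eps <= eps0 ->
  forall (x : R -> 'rV[R]_d) (Jx : set R),
    is_maximal_solution (fun t => f (t / eps)) phi x Jx ->
    `[- r, L] `<=` Jx /\
    forall t : R, 0 <= t -> t <= L -> N (x t - y t) < delta.
Proof.
move=> delta delta0.
have [C [C0 HC]] := norm_equivalence hN.
have NC x : N x <= C * `|x| by have [] := HC x.
have CN x : `|x| <= C * N x by have [] := HC x.
have lt_of_N (x : 'rV[R]_d) (eta : R) : N x < eta / C -> `|x| < eta.
  by move=> H; apply: le_lt_trans (CN x) _; rewrite mulrC -ltr_pdivlMr.
have cf : continuous_field f.
  move=> t u t0 eta eta0; have eC : 0 < eta / C by rewrite divr_gt0.
  have [k k0 Hk] := hf t u t0 _ eC.
  have k2 : 0 < k / 2 / C by rewrite !divr_gt0.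
  exists (Num.min k (k / 2 / C)); first by rewrite lt_min k0.
  move=> t' u' t'0; rewrite lt_min => /andP[tt' _] uu'.
  apply/lt_of_N/Hk => //; apply: (Cdist_lt hr C0 NC k0) => th.
  by have := uu' th; rewrite lt_min => /andP[].
have equi (u : Cspace d r) (eta : R) : 0 < eta -> exists2 kappa : R, 0 < kappa &
    forall (t : R) (u' : Cspace d r), 0 <= t ->
      (forall th, `|u' th - u th| < kappa) -> `|f t u' - f t u| < eta.
  move=> eta0; have eC : 0 < eta / C by rewrite divr_gt0.
  have [k k0 Hk] := H1 u _ eC.
  exists (k / 2 / C); first by rewrite !divr_gt0.
  by move=> t u' t0 uu'; apply/lt_of_N/Hk => //; exact: (Cdist_lt hr C0 NC k0).
have bf : bounded_field f.
  move=> M; have [|K HK] := H2 [set u : Cspace d r | forall th, `|u th| <= M].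
    exists (C * M) => u uM; apply: Cnorm_le => // th.
    by apply: le_trans (NC _) _; rewrite ler_pM2l.
  (* The maximum is taken because [K] could be negative. *)
  exists (Num.max 0 (C * K)); first by rewrite le_max lexx.
  move=> t u t0 uM; rewrite le_max; apply/orP; right.
  by apply: le_trans (CN _) _; rewrite ler_pM2l//; exact: HK.
have dC : 0 < delta / C by rewrite divr_gt0.
have [[sy _] uy] := H6.
apply: contrapT => noeps.
(* The negated claim is used with [eps0 := harmonic n]. The tube of radius [delta / C] in the
   library norm lies inside the [N]-tube of radius [delta], so a counterexample must leave it. *)
have bad n : exists p : R * (R -> 'rV[R]_d) * set R * R,
    let: (e, x, Jx, t) := p in
    [/\ 0 < e, e <= harmonic n, is_solution (fun t => f (t / e)) phi x Jx &
      [/\ Jx t, 0 <= t <= L, delta / C <= `|x t - y t| &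
        forall s : R, 0 <= s -> s < t -> `|x s - y s| < delta / C]].
  apply: contrapT => nop; apply: noeps; exists (harmonic n).
    by rewrite invr_gt0 ltr0n.
  move=> e e0 en x Jx mx; apply: contrapT => badx; apply: nop.
  have [|t Ht] := @first_exit_solution _ _ _ _ _ phi x y Jx J L (delta / C)
      (continuous_field_rescale e0 cf) (bounded_field_rescale e0 bf) hr
      (ltW hLpos) mx sy hLJ.
    move=> JL close; apply: badx; split; first exact: (solution_itv hr mx.1 JL).
    move=> t t0 tL; apply: le_lt_trans (NC _) _.
    by rewrite -ltr_pdivlMl// mulrC close.
  by exists (e, x, Jx, t); split=> //; exact: mx.1.
have [p Hp] := choice bad.
apply: (@averaging_limit R d r f F phi y J L (delta / C)
  (fun n => (p n).1.1.1) (fun n => (p n).2) (fun n => (p n).1.1.2)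
  (fun n => (p n).1.2)) => //.
- exact: ltW.
- by move=> n; have := Hp n; case: (p n) => [[[e x] Jx] t] [].
- apply: (@squeeze_cvgr _ _ _ _ (fun=> 0) harmonic); last exact: cvg_harmonic.
    apply: nearW => n; have := Hp n; case: (p n) => [[[e x] Jx] t] [e0 en _ _] /=.
    by rewrite (ltW e0).
  exact: cvg_cst.
- by move=> n; have := Hp n; case: (p n) => [[[e x] Jx] t] [].
- by move=> n; have := Hp n; case: (p n) => [[[e x] Jx] t] [].
Qed.
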